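(* Consider the multi-input, distinct-delay nonlinear system $$\dot X(t) = f\big(X(t), U_1(t-D_1),\dots,U_m(t-D_m)\big),$$ with $X(t)\in\mathbb{R}^n$, scalar inputs $U_1,\dots,U_m$, delays $0<D_1\le\dots\le D_m$, and $f:\mathbb{R}^n\times\mathbb{R}^m\to\mathbb{R}^n$ locally Lipschitz with $f(0,\dots,0)=0$. Let $\mathcal{X}\subset\mathbb{R}^n$, $\mathcal{U}\subset\mathbb{R}$ be compact sets with upper bounds $\overline{\mathcal{X}},\overline{\mathcal{U}}$ (that is, $|x|\le\overline{\mathcal{X}}$ for $x\in\mathcal{X}$ and $|u|\le\overline{\mathcal{U}}$ for $u\in\mathcal{U}$). Assume: (1) There are $\kappa_i\in C^1(\mathbb{R}^n;\mathbb{R})$, $i=1,\dots,m$, such that the delay-free system $\dot X=f(X,\kappa_1(X),\dots,\kappa_m(X))$ is globally asymptotically stable. (2) There is $C_f>0$ with $|f(x_1,u_1,\dots,u_m)-f(x_2,u_{m+1},\dots,u_{2m})|\le C_f\big(|x_1-x_2|+\sum_{i=1}^m|u_i-u_{m+i}|\big)$ for all $x_1,x_2\in\mathcal{X}$ and $u_1,\dots,u_{2m}\in\mathcal{U}$. (3) The system $\dot X=f(X,\omega_1,\dots,\omega_m)$ is strongly forward complete with respect to $\omega=(\omega_1,\dots,\omega_m)^T$. (4) The system $\dot X=f(X,\omega_1+\kappa_1(X),\dots,\omega_m+\kappa_m(X))$ is input-to-state stable with respect to $\omega=(\omega_1,\dots,\omega_m)^T$. (5) For every $j=1,\dots,m$,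 the system $\dot X=f(X,\kappa_1(X),\dots,\kappa_j(X),\omega_{j+1},\dots,\omega_m)$ is strongly forward complete with respect to $(\omega_{j+1},\dots,\omega_m)^T$. Let $\overline{\mathcal{B}}:=\min\{\overline{\mathcal{X}},\overline{\mathcal{U}}\}$. Then there exist functions $\alpha_1\in\mathcal{K}$ and $\beta\in\mathcal{KL}$ such that the following holds. Put $\alpha_2(r):=\beta(r,0)$ for $r\ge0$, $$\epsilon^*(\overline{\mathcal{B}}):=\alpha_1^{-1}(\overline{\mathcal{B}})/m,\qquad \Omega(\epsilon,\overline{\mathcal{B}}):=\alpha_2^{-1}\big(\overline{\mathcal{B}}-\alpha_1(m\epsilon)\big).$$ If $0<\epsilon<\epsilon^*(\overline{\mathcal{B}})$, if the neural operators $\hat{\mathcal{P}}_1,\dots,\hat{\mathcal{P}}_m$ approximate the predictor operators $\mathcal{P}_1,\dots,\mathcal{P}_m$ with uniform error $\epsilon$ (in the sense given in the context, semiglobally trained with $\overline{\mathcal{B}}>\alpha_2(\Omega)$), and if the initial state satisfies $\Gamma(0)\le\Omega(\epsilon,\overline{\mathcal{B}})$, then the closed-loop solutions under the controller $U_i(t)=\kappa_i(\hat P_i(t))$, $i=1,\dots,m$, satisfy $$\Gamma(t)\le\beta(\Gamma(0),t)+\alpha_1(m\epsilon)\qquad\text{for all }t\ge0,$$ where $\Gamma(t)=|X(t)|+\sum_{i=1}^m\|u_i(t)\|_{L^\infty}$ and $u_i(x,t)=U_i(t+x-D_i)$ for $x\in[0,D_i)$.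
   Context: Notation. $|\cdot|$ is the Euclidean norm; $\|u_i(t)\|_{L^\infty}=\sup_x|u_i(x,t)|$ over the spatial domain $x\in[0,D_i)$ of $u_i$; $\mathbb{R}_+$ is the set of positive reals. $\mathcal{K}$ and $\mathcal{KL}$ are the usual comparison function classes. $D_{i,j}:=D_i-D_j$, with the convention $D_0:=0$. The closed loop is equivalently $\dot X(t)=f(X(t),u_1(0,t),\dots,u_m(0,t))$, $\partial_tu_i=\partial_xu_i$ on $x\in[0,D_i)$, $u_i(D_i,t)=\kappa_i(\hat P_i(t))$. Strong forward completeness. A system $\dot X=f(X,\omega)$ is strongly forward complete with respect to $\omega$ if there exist a smooth positive definite function $R:\mathbb{R}^n\to\mathbb{R}$ and class $\mathcal{K}_\infty$ functions $a_1,a_2,a_3$ such that $a_1(|X|)\le R(X)\le a_2(|X|)$ and $\frac{\partial R(X)}{\partial X}f(X,\omega)\le R(X)+a_3(|\omega|)$ for all $X$ and $\omega$. Predictor operators. For $i\in\{1,\dots,m\}$, $\mathcal{P}_i:\mathbb{R}^n\times C^1([0,1];\mathbb{R})^{m-i+1}\times\mathbb{R}_+\to C^1([0,1];\mathbb{R}^n)$ maps $(Q,V_i,\dots,V_m,\varphi)$ to the function $P_i$ solving $$P_i(s)=Q+\varphi\int_0^sf\big(P_i(\theta),\kappa_1(P_i(\theta)),\dots,\kappa_{i-1}(P_i(\theta)),V_i(\theta),\dots,V_m(\theta)\big)\,d\theta,\quad s\in[0,1].$$ Control histories. For $a\ge b\ge0$, $(T_{a,b}(t)U)(x):=U(t-a+(a-b)x)$,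 $x\in[0,1)$. Approximate predictors. Given operators $\hat{\mathcal{P}}_i$ with the same inputs and outputs as $\mathcal{P}_i$, define recursively, with $\hat P_0(t):=X(t)$, $$\hat P_i(t)=\hat{\mathcal{P}}_i\big(\hat P_{i-1}(t),\,T_{D_{i,i-1},D_{i,i}}(t)U_i,\,T_{D_{i+1,i-1},D_{i+1,i}}(t)U_{i+1},\dots,T_{D_{m,i-1},D_{m,i}}(t)U_m,\,D_{i,i-1}\big)(1).$$ (So for example the first history in $\hat P_1$ is $T_{D_1,0}(t)U_1$ with $\varphi=D_1$.) Uniform error $\epsilon$. The operators $\hat{\mathcal{P}}_i$ are neural operators such that, for each $i$, $$\|\mathcal{P}_i(X,V_i,\dots,V_m,\varphi)-\hat{\mathcal{P}}_i(X,V_i,\dots,V_m,\varphi)\|_{L^\infty}<\epsilon$$ over $X\in\mathcal{X}$, $V_j\in C^1([0,1];\mathcal{U})$, $\varphi\in\Phi$, where $\Phi\subset\mathbb{R}_+$ is a bounded set containing the delay differences $D_{i,i-1}$ used above. Neural operator. A map of the form $\mathcal{Q}\circ\mathcal{L}_L\circ\dots\circ\mathcal{L}_1\circ\mathcal{R}$ between spaces of continuous functions on $[0,1]$ (vector and scalar inputs being regarded as constant functions), where $\mathcal{R}$ is the lifting $c(x)\mapsto R(c(x),x)\in\mathbb{R}^{d_c}$ for a neural network $R$; $(\mathcal{L}_lv)(x)=\sigma\big(W_lv(x)+b_l+\int_0^1K_l(x,y)v(y)\,dy\big)$ with learnable $W_l\in\mathbb{R}^{d_c\times d_c}$, $b_l\in\mathbb{R}^{d_c}$,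 a parametrized kernel function $K_l$, and a smooth activation $\sigma:\mathbb{R}\to\mathbb{R}$ acting componentwise; and $\mathcal{Q}$ is the projection $v(x)\mapsto Q(v(x),x)$ for a neural network $Q$.
   Formalization: ''Semiglobally trained'' is taken to mean that the sets X and U contain all points of norm at most B = min of their upper bounds; with mere upper bounds the claim fails, e.g. X = U = {0} with zero approximate predictors and an unstable plant. *)

(* Defs.v *)
From HB Require Import structures.
From mathcomp Require Import all_boot all_order all_algebra.
From mathcomp Require Import all_classical all_reals all_analysis.

Set Implicit Arguments.
Unset Strict Implicit.
Unset Printing Implicit Defensive.

Import Order.TTheory GRing.Theory Num.Theory.
Import numFieldNormedType.Exports.

Local Open Scope classical_set_scope.
Local Open Scope ring_scope.

(* The library norm `|x| on 'rV[R]_n is the sup norm; the estimates below are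
   stated with the Euclidean one. *)
Definition enorm (R : realType) (n : nat) (x : 'rV[R]_n) : R :=
  Num.sqrt (\sum_i x 0 i ^+ 2).

(* Comparison functions are total functions on R of which only the restriction
   to [0, +oo[ matters. *)
Definition class_K (R : realType) (a : R -> R) : Prop :=
  [/\ {within `[0, +oo[, continuous a},
      forall r s, 0 <= r -> r < s -> a r < a s
    & a 0 = 0].

Definition class_Kinfty (R : realType) (a : R -> R) : Prop :=
  class_K a /\ a r @[r --> +oo] --> +oo.

Definition class_KL (R : realType) (b : R -> R -> R) : Prop :=
  [/\ {within `[0, +oo[ `*` `[0, +oo[, continuous (fun z : R * R => b z.1 z.2)},
      forall t, 0 <= t -> class_K (b^~ t),
      forall r s t, 0 <= r -> 0 <= s -> s <= t -> b r t <= b r s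
    & forall r, 0 <= r -> b r t @[t --> +oo] --> 0].

(* The inverse on the range of a; junk value 0 outside of it. *)
Definition K_inv (R : realType) (a : R -> R) (y : R) : R :=
  xget 0 [set r | 0 <= r /\ a r = y].

Definition in_K_range (R : realType) (a : R -> R) (y : R) : Prop :=
  exists2 r, 0 <= r & a r = y.

Definition locally_lipschitz (R : realType) (n m : nat)
    (f : 'rV[R]_n -> 'rV[R]_m -> 'rV[R]_n) : Prop :=
  forall z : 'rV[R]_n * 'rV[R]_m,
    exists2 N, nbhs z N & [lipschitz (f y.1 y.2) | y in N].

(* C^k on R^n: continuous, with partial derivatives that exist everywhere and
   are C^(k-1). *)
Fixpoint Ck (R : realType) (n k : nat) (g : 'rV[R]_n -> R) : Prop :=
  continuous g /\
  if k is k'.+1 then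
    forall i : 'I_n, (forall x, derivable g x (delta_mx 0 i)) /\
                     Ck k' ('D_(delta_mx 0 i) g)
  else True.

Definition smooth (R : realType) (n : nat) (g : 'rV[R]_n -> R) : Prop :=
  forall k, Ck k g.

Definition smooth1 (R : realType) (s : R -> R) : Prop :=
  forall k x, derivable (derive1n k (s : R -> R^o)) x 1.

(* C^1 up to the boundary of an interval A: the derivative in the interior
   extends continuously to A. *)
Definition C1_on (R : realType) (W : normedModType R) (A : set R) (g : R -> W)
    : Prop :=
  {within A, continuous g} /\
  exists2 g' : R -> W, {within A, continuous g'} &
    forall x, interior A x -> is_derive x (1 : R) g (g' x).

Definition vintegral (R : realType) (n : nat) (A : set R) (g : R -> 'rV[R]_n)
    : 'rV[R]_n :=
  \row_j \int[@lebesgue_measure R]_(s in A) g s 0 j.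

Definition ode_solution (R : realType) (n : nat)
    (F : R -> 'rV[R]_n -> 'rV[R]_n) (X : R -> 'rV[R]_n) : Prop :=
  {within `[0, +oo[, continuous X} /\
  forall t : R, 0 < t -> is_derive t (1 : R) X (F t (X t)).

(* Global asymptotic stability of the origin for X' = F(X). *)
Definition GAS (R : realType) (n : nat) (F : 'rV[R]_n -> 'rV[R]_n) : Prop :=
  let sol := ode_solution (fun _ : R => F) in
  [/\ forall x0, exists2 X, sol X & X 0 = x0,
      forall e, 0 < e -> exists2 d, 0 < d &
        forall X, sol X -> enorm (X 0) < d -> forall t, 0 <= t -> enorm (X t) < e
    & forall X, sol X -> enorm (X t) @[t --> +oo] --> (0 : R)].

(* Caratheodory solutions of X' = g(X, w) on [0, T], as needed for inputs w that
   are merely measurable. *)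
Definition caratheodory_solution (R : realType) (n p : nat)
    (g : 'rV[R]_n -> 'rV[R]_p -> 'rV[R]_n) (T : R)
    (w : R -> 'rV[R]_p) (X : R -> 'rV[R]_n) : Prop :=
  {within `[0, T], continuous X} /\
  forall t, t \in `[0, T] -> X t = X 0 + vintegral `[0, t] (fun s => g (X s) (w s)).

Definition admissible_input (R : realType) (p : nat) (T : R) (w : R -> 'rV[R]_p)
    : Prop :=
  (forall j, measurable_fun (`[0, T] : set R) (fun s => w s 0 j)) /\
  exists M, forall s, s \in `[0, T] -> enorm (w s) <= M.

Definition ISS (R : realType) (n p : nat)
    (g : 'rV[R]_n -> 'rV[R]_p -> 'rV[R]_n) : Prop :=
  exists beta gamma, [/\ class_KL beta, class_K gamma &
    forall T w X, 0 <= T -> admissible_input T w -> caratheodory_solution g T w X ->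
    forall t, t \in `[0, T] ->
      enorm (X t) <= beta (enorm (X 0)) t + gamma (sup [set enorm (w s) | s in `[0, t]])].

Definition strongly_forward_complete (R : realType) (n p : nat)
    (g : 'rV[R]_n -> 'rV[R]_p -> 'rV[R]_n) : Prop :=
  exists (V : 'rV[R]_n -> R) (a1 a2 a3 : R -> R),
  [/\ smooth V,
      V 0 = 0 /\ (forall x, x != 0 -> 0 < V x),
      [/\ class_Kinfty a1, class_Kinfty a2 & class_Kinfty a3],
      forall x, a1 (enorm x) <= V x /\ V x <= a2 (enorm x)
    & forall x w,
        \sum_(i < n) 'D_(delta_mx 0 i) V x * g x w 0 i <= V x + a3 (enorm w)].

(* Indexing: states, inputs and feedback laws are numbered from 0 by 'I_m, so
   index i here is index i+1 in one-based numbering. Delays are numbered from 1,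
   D : nat -> R, with D 0 = 0; input i has delay D i.+1. *)

(* The input vector (kappa_1(x), ..., kappa_j(x), w_1, ..., w_(m-j)); the value 0
   is never reached. *)
Definition mixed_input (R : realType) (n m : nat) (kappa : 'I_m -> 'rV[R]_n -> R)
    (j : nat) (x : 'rV[R]_n) (w : 'rV[R]_(m - j)) : 'rV[R]_m :=
  \row_(k < m) if (k < j)%N then kappa k x else oapp (w 0) 0 (insub (k - j)%N).

Lemma tail_ord_subproof (m i : nat) (l : 'I_(m - i)) : (i + l < m)%N.
Proof. by rewrite -ltn_subRL. Qed.

Definition tail_ord (m i : nat) (l : 'I_(m - i)) : 'I_m :=
  Ordinal (tail_ord_subproof l).

(* Families of operators. The i-th member takes a state Q, the m - i functions
   V_i, ..., V_(m-1) on [0, 1], bundled into one vector-valued function, and a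
   scalar phi, and returns a function on [0, 1]. Functions on [0, 1] are
   represented by total functions on R, of which only the values on [0, 1]
   matter, and only the members with i < m are used. *)
Definition operators (R : realType) (n m : nat) : Type :=
  forall i : nat, 'rV[R]_n -> (R -> 'rV[R]_(m - i)) -> R -> R -> 'rV[R]_n.

(* phi = 0 is included: it is the value of D i.+1 - D i for two equal delays. *)
Definition maps_C1 (R : realType) (n m : nat) (G : operators R n m) : Prop :=
  forall (i : nat) Q (V : R -> 'rV[R]_(m - i)) phi, (i < m)%N ->
    C1_on `[0, 1] V -> 0 <= phi -> C1_on `[0, 1] (G i Q V phi).

Definition predictor_operators (R : realType) (n m : nat)
    (f : 'rV[R]_n -> 'rV[R]_m -> 'rV[R]_n) (kappa : 'I_m -> 'rV[R]_n -> R)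
    (P : operators R n m) : Prop :=
  maps_C1 P /\
  forall (i : nat) Q (V : R -> 'rV[R]_(m - i)) phi, (i < m)%N ->
    C1_on `[0, 1] V -> 0 <= phi ->
    forall s, s \in `[0, 1] ->
      P i Q V phi s =
        Q + phi *: vintegral `[0, s]
          (fun th => f (P i Q V phi th) (mixed_input kappa (P i Q V phi th) (V th))).

(* Feed-forward networks; vectors are rows, so weights act on the right. *)
Inductive neural_network (R : realType)
    : forall a b : nat, ('rV[R]_a -> 'rV[R]_b) -> Prop :=
| nn_affine (a b : nat) (W : 'M[R]_(a, b)) (c : 'rV[R]_b) :
    neural_network (fun x : 'rV[R]_a => x *m W + c)
| nn_layer (a b d : nat) (h : 'rV[R]_a -> 'rV[R]_b) (s : R -> R)
    (W : 'M[R]_(b, d)) (c : 'rV[R]_d) :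
    neural_network h -> continuous s ->
    neural_network (fun x => map_mx s (h x) *m W + c).

Record integral_layer (R : realType) (d : nat) := IntegralLayer {
  layer_weight : 'M[R]_d ;
  layer_bias : 'rV[R]_d ;
  layer_kernel : R -> R -> 'M[R]_d ;
  layer_kernel_continuous :
    {within `[0, 1] `*` `[0, 1],
      continuous (fun z : R * R => layer_kernel z.1 z.2)} }.

Definition eval_layer (R : realType) (d : nat) (sigma : R -> R)
    (L : integral_layer R d) (v : R -> 'rV[R]_d) : R -> 'rV[R]_d :=
  fun x => map_mx sigma (v x *m layer_weight L + layer_bias L
    + vintegral `[0, 1] (fun y => v y *m layer_kernel L x y)).

(* Neural operators with a state Q, functions V and a scalar phi as inputs, Q and
   phi being regarded as constant functions; layers are listed in order of
   application. *)
Definition neural_operator (R : realType) (n p : nat)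
    (G : 'rV[R]_n -> (R -> 'rV[R]_p) -> R -> R -> 'rV[R]_n) : Prop :=
  exists (d : nat) (lift : 'rV[R]_(n + p + 1 + 1) -> 'rV[R]_d)
    (sigma : R -> R) (layers : seq (integral_layer R d))
    (proj : 'rV[R]_(d + 1) -> 'rV[R]_n),
  [/\ neural_network lift, smooth1 sigma, neural_network proj &
    forall Q V phi x, C1_on `[0, 1] V -> 0 <= phi -> x \in `[0, 1] ->
      let lifted y := lift (row_mx (row_mx (row_mx Q (V y)) (const_mx phi)) (const_mx y)) in
      let v := foldl (fun v L => eval_layer sigma L v) lifted layers in
      G Q V phi x = proj (row_mx (v x) (const_mx x))].

Definition uniform_error (R : realType) (n m : nat) (P Phat : operators R n m)
    (XX : set 'rV[R]_n) (UU : set R) (Phi : set R) (eps : R) : Prop :=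
  forall (i : nat) Q (V : R -> 'rV[R]_(m - i)) phi, (i < m)%N ->
    XX Q -> C1_on `[0, 1] V -> (forall s, s \in `[0, 1] -> forall l, UU (V s 0 l)) ->
    Phi phi ->
    sup [set enorm (P i Q V phi s - Phat i Q V phi s) | s in `[0, 1]] < eps.

(* The training domain covers the balls of radius B, which exceeds r. *)
Definition semiglobally_trained (R : realType) (n : nat)
    (XX : set 'rV[R]_n) (UU : set R) (B r : R) : Prop :=
  [/\ forall x, enorm x <= B -> XX x, forall u, `|u| <= B -> UU u & r < B].

(* T_(a,b)(t) U *)
Definition history (R : realType) (a b t : R) (U : R -> R) : R -> R :=
  fun x => U (t - a + (a - b) * x).

Fixpoint approx_predictor (R : realType) (n m : nat) (Phat : operators R n m)
    (D : nat -> R) (X : R -> 'rV[R]_n) (U : 'I_m -> R -> R) (i : nat) (t : R)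
    : 'rV[R]_n :=
  if i is i'.+1 then
    Phat i' (approx_predictor Phat D X U i' t)
      (fun x => \row_(l < m - i')
         history (D (i' + l).+1 - D i') (D (i' + l).+1 - D i'.+1) t
                 (U (tail_ord l)) x)
      (D i'.+1 - D i') 1
  else X t.

(* The operators act on C^1 histories, so for the approximate predictors to be
   defined at all times t >= 0 each U_i must be C^1 on [-D_i, +oo[. *)
Definition closed_loop_solution (R : realType) (n m : nat)
    (f : 'rV[R]_n -> 'rV[R]_m -> 'rV[R]_n) (kappa : 'I_m -> 'rV[R]_n -> R)
    (D : nat -> R) (Phat : operators R n m)
    (X : R -> 'rV[R]_n) (U : 'I_m -> R -> R) : Prop :=
  [/\ ode_solution (fun t x => f x (\row_(i < m) U i (t - D i.+1))) X,
      forall i : 'I_m, C1_on `[- D i.+1, +oo[ (U i : R -> R^o)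
    & forall (i : 'I_m) t, 0 <= t ->
        U i t = kappa i (approx_predictor Phat D X U i.+1 t)].

Definition Gamma (R : realType) (n m : nat) (D : nat -> R)
    (X : R -> 'rV[R]_n) (U : 'I_m -> R -> R) (t : R) : R :=
  enorm (X t) +
  \sum_(i < m) sup [set `|U i (t + x - D i.+1)| | x in `[0, D i.+1[].

Definition eps_star (R : realType) (m : nat) (alpha1 : R -> R) (B : R) : R :=
  K_inv alpha1 B / m%:R.

Definition Omega (R : realType) (m : nat) (alpha1 : R -> R) (beta : R -> R -> R)
    (eps B : R) : R :=
  K_inv (beta^~ 0) (B - alpha1 (m%:R * eps)).

(* Main.v *)
Require Import Defs.
From HB Require Import structures.
From mathcomp Require Import all_boot all_order all_algebra.
From mathcomp Require Import all_classical all_reals all_analysis.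
From mathcomp Require Import measurable_realfun ring lra.

(** Since beta and alpha1 may depend on B, taking both steep at 0 makes
    Gamma(0) + eps as small as needed, and the argument becomes local at 0. Put
    W_i(t) = U_i(t - D_i) and let q_i(t) be the i-th approximate predictor at
    time t - D_i, an estimate of X(t); then W_i(t) = kappa_i(q_i(t)) for
    t >= D_i. While X and W stay in a ball on which f and kappa are Lipschitz,
    Gronwall's inequality for the predictor equations gives q_i - X = O(eps),
    so that W_i - kappa_i(X) = O(eps) from time D_i on. Gronwall again controls
    X up to time D_m, and input-to-state stability controls it afterwards; the
    resulting bound lies strictly inside the ball, which closes a continuous
    induction on time. If kappa_i(0) <> 0 for some i, no solution has small
    data, because U_i(0) = kappa_i(P_i(0)). *)

Set Implicit Arguments.
Unset Strict Implicit.
Unset Printing Implicit Defensive.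

Import Order.TTheory GRing.Theory Num.Theory.
Import numFieldNormedType.Exports.

Local Open Scope classical_set_scope.
Local Open Scope ring_scope.

(** * Norms *)

(** Indexing by plant time lets all stages aim at the same state [X t]: stage i+1 integrates over
    the interval of length [D i.+1 - D i] ending at t, with exactly the inputs that enter the plant
    there, except that the first i of them are replaced by feedbacks of the predicted state. This
    replacement is the circular point, since its error is that of the earlier stages at all times of
    the interval. An induction on the stage, for all times at once, breaks the circle and costs a
    constant factor per stage, so m stages cost [gain ^+ m]. The assumptions do not make the
    feedbacks vanish at 0, yet all local estimates are centred at zero state and zero input. The
    case of a nonzero [kappa k 0] therefore has to be excluded before any bound on the trajectory
    exists; there the predictors are compared with the zero solution instead of X. All constants
    depend only on f, kappa, the delays, the input-to-state gains and B, so they can be fixed before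
    eps and the operators are given. *)

Lemma mx_coord_le (R : realType) (p q : nat) (M : 'M[R]_(p, q)) i j :
  `|M i j| <= `|M|.
Proof. by rewrite [leRHS]/Num.Def.normr /= mx_normrE; apply: (le_bigmax _ _ (i, j)). Qed.

Lemma mx_norm_le (R : realType) (p q : nat) (M : 'M[R]_(p, q)) c :
  0 <= c -> (forall i j, `|M i j| <= c) -> `|M| <= c.
Proof.
move=> c0 Mc; rewrite [leLHS]/Num.Def.normr /= mx_normrE.
by apply: bigmax_le => // -[i j] _; exact: Mc.
Qed.

Lemma mx_norm_lt (R : realType) (p q : nat) (M : 'M[R]_(p, q)) c :
  0 < c -> (forall i j, `|M i j| < c) -> `|M| < c.
Proof.
move=> c0 Mc; rewrite [ltLHS]/Num.Def.normr /= mx_normrE.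
by apply: bigmax_lt => // -[i j] _; exact: Mc.
Qed.

Lemma enorm_ge0 (R : realType) (n : nat) (x : 'rV[R]_n) : 0 <= enorm x.
Proof. exact: sqrtr_ge0. Qed.

Lemma norm_le_enorm (R : realType) (n : nat) (x : 'rV[R]_n) : `|x| <= enorm x.
Proof.
apply: mx_norm_le => [|i j]; first exact: enorm_ge0.
rewrite ord1 -sqrtr_sqr; apply: ler_wsqrtr.
by rewrite (bigD1 j) //= lerDl; apply: sumr_ge0 => k _; exact: sqr_ge0.
Qed.

Lemma enorm_le_norm (R : realType) (n : nat) (x : 'rV[R]_n) : enorm x <= n%:R * `|x|.
Proof.
rewrite -[leRHS]ger0_norm ?mulr_ge0 // -sqrtr_sqr; apply: ler_wsqrtr.
apply: (@le_trans _ _ (\sum_(i < n) `|x| ^+ 2)).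
  apply: ler_sum => i _; rewrite -real_normK ?num_real //.
  by rewrite ler_sqr ?nnegrE //; exact: mx_coord_le.
rewrite sumr_const card_ord exprMn -[leLHS]mulr_natl ler_wpM2r ?sqr_ge0 //.
by rewrite -natrX ler_nat; case: (n) => // k; rewrite leq_pmulr.
Qed.

(** * Continuous induction and Gronwall's inequality *)

Lemma is_derive_coord (R : realType) (p q : nat) (M : R -> 'M[R]_(p, q)) t v dM i j :
  is_derive t v M dM -> is_derive t v (fun x => M x i j) (dM i j).
Proof.
move=> [dr <-]; split; first by move/derivable_mxP : dr.
by rewrite derive_mx // mxE.
Qed.

Lemma is_derive_mx (R : realType) (p q : nat) (M : R -> 'M[R]_(p, q)) t v
    (dM : 'M[R]_(p, q)) :
  (forall i j, is_derive t v (fun x => M x i j) (dM i j)) -> is_derive t v M dM.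
Proof.
move=> h; have dr : derivable M t v by apply/derivable_mxP => i j; case: (h i j).
split => //; rewrite derive_mx //; apply/matrixP => i j; rewrite mxE.
exact: derive_val.
Qed.

(** The infimum of the times with [g >= 0] has a purely negative past, so [g] is negative there, and
    by continuity also just to the right of it. At [s = 0] the past is empty, so the hypothesis
    contains [g 0 < 0]. *)
Lemma first_exit (R : realType) (T : R) (g : R -> R) :
  {within `[0, T], continuous g} ->
  (forall s, 0 <= s <= T -> (forall s', 0 <= s' < s -> g s' < 0) -> g s < 0) ->
  forall s, 0 <= s <= T -> g s < 0.
Proof.
move=> gc step t tT; apply/negPn/negP; rewrite -leNgt => gt.
pose S := [set s | 0 <= s <= T /\ 0 <= g s].
have Sinf : has_inf S.
  by split; [exists t | exists 0 => s [/andP[]]].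
have S0 : 0 <= inf S by apply: lb_le_inf; [exists t | move=> s [/andP[]]].
have iT : 0 <= inf S <= T.
  rewrite S0 /=; apply: le_trans (_ : t <= _); last by case/andP: tT.
  by apply: ge_inf; [case: Sinf | split].
have gi : g (inf S) < 0.
  apply: step => // s' /andP[s0 sS]; rewrite ltNge; apply/negP => gs.
  move: (sS); rewrite ltNge => /negP; apply; apply: ge_inf; first by case: Sinf.
  by split => //; rewrite s0 /= (le_trans (ltW sS)) //; case/andP: iT.
move/subspace_continuousP : gc => /(_ (inf S)).
rewrite /= in_itv /= iT => /(_ isT) /cvgrPdist_lt /(_ (- g (inf S))).
rewrite oppr_gt0 => /(_ gi); rewrite near_withinE => /nbhs_ballP[e /= e0 he].
have [s [sT gs] se] := inf_adherent e0 Sinf.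
have ss : inf S <= s by apply: ge_inf; [case: Sinf | split].
have := he s; rewrite /ball /= in_itv /= => /(_ _ sT) h.
have {}h : `|g (inf S) - g s| < - g (inf S).
  by apply: h; rewrite distrC ger0_norm ?subr_ge0 // ltrBlDl.
move: h; rewrite ltr_norml => /andP[+ _]; rewrite opprK; lra.
Qed.

Lemma within_le_left (R : realType) (g : R -> R) (b c : R) :
  {within `[0, b], continuous g} -> 0 < b -> (forall t, 0 <= t < b -> g t <= c) -> g b <= c.
Proof.
move=> gc b0 gtc; rewrite leNgt; apply/negP => cb.
move/subspace_continuousP : gc => /(_ b).
rewrite /= in_itv /= lexx (ltW b0) => /(_ isT) /cvgrPdist_lt /(_ (g b - c)).
rewrite subr_gt0 => /(_ cb); rewrite near_withinE => /nbhs_ballP[e /= e0 he].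
pose t := Num.max 0 (b - e / 2).
have t0 : 0 <= t by rewrite le_max lexx.
have tb : t < b by rewrite gt_max b0 /=; lra.
have bt : b - t < e.
  by rewrite ltrBlDl -ltrBlDr lt_max; apply/orP; right; lra.
have := he t; rewrite /ball /= gtr0_norm ?subr_gt0 // in_itv /= t0 (ltW tb).
move=> /(_ bt isT); rewrite ltr_norml => /andP[_].
by have := gtc t; rewrite t0 tb /from_subspace => /(_ isT); lra.
Qed.

(** The form suited to a priori bounds: a weak inequality up to and including s is improved to a
    strict one at s. Closing the past at its right end uses the left limit, except at 0, where
    [g 0 <= 0] is assumed. *)
Lemma continuous_induction (R : realType) (g : R -> R) :
  {within `[0, +oo[, continuous g} -> g 0 <= 0 ->
  (forall s, 0 <= s -> (forall s', 0 <= s' <= s -> g s' <= 0) -> g s < 0) ->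
  forall s, 0 <= s -> g s < 0.
Proof.
move=> gc g0 step s s0.
have sub (t : R) : `[0, t] `<=` `[0, +oo[.
  by move=> x /=; rewrite !in_itv /= andbT => /andP[].
suff h t : 0 <= t <= s -> (forall s', 0 <= s' < t -> g s' < 0) -> g t < 0.
  by apply: (first_exit (continuous_subspaceW (sub s) gc) h); rewrite s0 lexx.
move=> /andP[t0 _] gt; apply: step => // t' /andP[t'0].
rewrite le_eqVlt => /predU1P[->|t't]; last by rewrite ltW // gt // t'0.
move: t0; rewrite le_eqVlt => /predU1P[<- //|t0].
apply: (within_le_left (continuous_subspaceW (sub t) gc) t0) => u ut.
by rewrite ltW // gt.
Qed.

(* The differential inequality is only required where |z| < rho, so that the
   lemma applies to fields that are merely Lipschitz near 0. *)
Lemma gronwall (R : realType) (p q : nat) (T K a c rho : R) (z z' : R -> 'M[R]_(p, q)) :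
  0 <= K -> 0 <= c -> 0 <= T ->
  {within `[0, T], continuous z} ->
  (forall s : R, 0 < s < T -> is_derive s (1 : R) z (z' s)) ->
  (forall s : R, 0 < s < T -> `|z s| < rho -> `|z' s| <= K * `|z s| + c) ->
  `|z 0| < a -> (a + c * T) * expR (K * T) <= rho ->
  forall s : R, 0 <= s <= T -> `|z s| < (a + c * T) * expR (K * T).
Proof.
move=> K0 c0 T0 zc dz bz za arho.
have a0 : 0 < a by apply: le_lt_trans za; exact: normr_ge0.
(* A barrier: [G 0 = a], and [G' >= K * G + c] because [expR (K * s) >= 1]. Thus G grows at least as
   fast as [z] can while [z] stays below it. *)
pose G (s : R) := (a + c * s) * expR (K * s).
pose G' (s : R) := K * G s + c * expR (K * s).
have G_gt0 (s : R) : 0 <= s -> 0 < G s.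
  by move=> s0; rewrite mulr_gt0 ?expR_gt0 // ltr_wpDr // mulr_ge0.
have GT (s : R) : 0 <= s <= T -> G s <= (a + c * T) * expR (K * T).
  move=> /andP[s0 sT]; apply: ler_pM.
  - by rewrite addr_ge0 ?mulr_ge0 // ltW.
  - exact: expR_ge0.
  - by rewrite lerD2l ler_wpM2l.
  - by rewrite ler_expR ler_wpM2l.
have dG (s : R) : is_derive s (1 : R) G (G' s).
  have d1 : is_derive s (1 : R) (fun s : R => K * s) K.
    apply: is_derive_eq. by rewrite -[K%:A]/(K * 1) mulr1.
  have d2 := @is_derive1_comp R expR (fun s : R => K * s) s _ _ (is_derive_expR _) d1.
  have d3 : is_derive s (1 : R) (fun s : R => a + c * s) c.
    by apply: is_derive_eq; rewrite add0r mul1r -[c%:A]/(c * 1) mulr1.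
  have d4 := is_deriveM d3 d2.
  apply: (is_derive_eq d4); rewrite /G' /G /= -![_ *: _]/(_ * _); ring.
have Gc : continuous G.
  by move=> s; apply: differentiable_continuous; apply/derivable1_diffP; case: (dG s).
suff H s : 0 <= s <= T -> `|z s| - G s < 0.
  by move=> s sT; rewrite (lt_le_trans _ (GT _ sT)) // -subr_lt0 H.
move: s; apply: (@first_exit R T (fun s => `|z s| - G s)) => [|s sT Hs].
  move=> x; apply: cvgB; last by apply: continuous_subspaceT => y; exact: Gc.
  by apply: cvg_norm; exact: zc.
case/andP: (sT) => s0 sT'; rewrite subr_lt0.
move: s0; rewrite le_eqVlt => /predU1P[<-|s0].
  by rewrite /G !mulr0 expR0 mulr1 addr0.
apply: mx_norm_lt => [|i j]; first by rewrite G_gt0 // ltW.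
have bz' x : 0 < x < s -> `|z' x i j| <= G' x.
  move=> /andP[x0 xs]; apply: (le_trans (mx_coord_le _ _ _)).
  have zx : `|z x| < G x by rewrite -subr_lt0 Hs // xs ltW.
  have xT : x < T by exact: lt_le_trans sT'.
  apply: (le_trans (bz x _ _)); first by rewrite x0 xT.
    apply: (lt_le_trans zx); apply: le_trans arho; apply: GT.
    by rewrite !ltW.
  rewrite /G' lerD // ?ler_wpM2l //; first exact: ltW.
  rewrite ler_peMr // -expR0 ler_expR mulr_ge0 //; exact: ltW.
(* The sup norm is not differentiable, so each coordinate and its negative are compared with the
   barrier separately, by the mean value theorem for [G - h]. *)
have key (h h' : R -> R) : {within `[0, s], continuous h} ->
    (forall x : R, 0 < x < s -> is_derive x (1 : R) h (h' x)) ->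
    (forall x, 0 < x < s -> `|h' x| <= G' x) -> `|h 0| < a -> h s < G s.
  move=> hc dh bh ha.
  have [||x] := @MVT R (G - h) (G' - h') 0 s s0.
  - move=> x; rewrite in_itv /= => xs.
    by have dx := dh x xs; exact: is_deriveB.
  - move=> x; apply: cvgB; last exact: hc.
    by apply: continuous_subspaceT => y; exact: Gc.
  - rewrite in_itv /= => xs; rewrite !fctE subr0 => e.
    have := bh x xs; rewrite ler_norml => /andP[_ bx].
    have : 0 <= (G' x - h' x) * s by rewrite mulr_ge0 ?subr_ge0 // ltW.
    rewrite -e; move: ha; rewrite ltr_norml => /andP[_ ha].
    rewrite /G !mulr0 expR0; lra.
have zcs : {within `[0, s], continuous z}.
  by apply: continuous_subspaceW zc => x /=; rewrite !in_itv /= => /andP[-> /le_trans]; apply.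
have zijc : {within `[0, s], continuous (fun x => z x i j)}.
  move=> x; apply: (@continuous_comp _ _ _ (z : subspace _ -> _) (fun M : 'M[R]_(p, q) => M i j)).
    exact: zcs.
  exact: coord_continuous.
have sub (x : R) : 0 < x < s -> 0 < x < T.
  by move=> /andP[-> /lt_le_trans]; apply.
have a1 : `|z 0 i j| < a by apply: le_lt_trans za; exact: mx_coord_le.
rewrite ltr_norml ltrNl; apply/andP; split.
- apply: (key (fun x => - z x i j) (fun x => - z' x i j)); last 2 first.
  + by move=> x xs; rewrite normrN; exact: bz'.
  + by rewrite normrN.
  + by move=> x; apply: cvgN; exact: zijc.
  + move=> x xs; apply: is_deriveN; apply: is_derive_coord.
    by apply: dz; exact: sub.
- apply: (key (fun x => z x i j) (fun x => z' x i j)) => // x xs.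
  by apply: is_derive_coord; apply: dz; exact: sub.
Qed.

(** * Lipschitz bounds near the origin *)

Lemma lipschitz_on_line (R : realType) (n : nat) (g : 'rV[R]_n -> R) (e v : 'rV[R]_n)
    (M a b : R) :
  (forall x, derivable g x e) ->
  (forall s : R, `|s| <= Num.max `|a| `|b| -> `|'D_e g (s *: e + v)| <= M) ->
  `|g (b *: e + v) - g (a *: e + v)| <= M * `|b - a|.
Proof.
move=> dg; wlog ab : a b / a <= b => [h|] gM.
  have [/h|/ltW/h] := leP a b; first exact.
  by rewrite distrC (distrC b); apply; rewrite maxC.
pose phi (s : R) := g (s *: e + v).
have E (s : R) : (fun h : R => h^-1 *: (phi (h *: 1 + s) - phi s)) =
    (fun h => h^-1 *: (g (h *: e + (s *: e + v)) - g (s *: e + v))).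
  by apply/funext => h; rewrite /phi -[h *: 1]/(h * 1) mulr1 scalerDl addrA.
have dphi (s : R) : is_derive s (1 : R) phi ('D_e g (s *: e + v)).
  have := dg (s *: e + v); rewrite /derivable -E => dr.
  by split => //; rewrite /derive E.
have phic : {within `[a, b], continuous phi}.
  apply: continuous_subspaceT => s; apply: differentiable_continuous.
  by apply/derivable1_diffP; case: (dphi s).
have [c cab ->] := MVT_segment ab (fun x _ => dphi x) phic.
rewrite normrM ler_wpM2r //; apply: gM.
move: cab; rewrite in_itv /= => /andP[ac cb].
rewrite ler_norml; apply/andP; split.
  rewrite lerNl le_max; apply/orP; left.
  by rewrite -(normrN a) (le_trans _ (ler_norm _)) // lerN2.
by rewrite le_max; apply/orP; right; rewrite (le_trans cb) // ler_norm.
Qed.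

(** [Ck] provides partial derivatives only, which are bounded near 0 by continuity. The points x and
    y are joined by a path that changes one coordinate at a time and stays in the same sup-norm
    ball; this gives the factor n. *)
Lemma C1_lipschitz_near0 (R : realType) (n : nat) (g : 'rV[R]_n -> R) :
  Ck 1 g -> exists L r : R, [/\ 0 <= L, 0 < r &
    forall x y, `|x| <= r -> `|y| <= r -> `|g x - g y| <= L * `|x - y|].
Proof.
move=> [gc dg].
pose M := 1 + \sum_i `|'D_(delta_mx 0 i) g 0|.
have M0 : 0 <= M by rewrite addr_ge0 // sumr_ge0.
have near_i (i : 'I_n) : \forall x \near (0 : 'rV[R]_n), `|'D_(delta_mx 0 i) g x| <= M.
  have [_ [dc _]] := dg i.
  have /cvgrPdist_lt /(_ 1 ltr01) := dc 0.
  apply: filterS => x hx.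
  rewrite /M (bigD1 i) //= -(subrK ('D_(delta_mx 0 i) g 0) ('D_(delta_mx 0 i) g x)).
  apply: (le_trans (ler_normD _ _)); rewrite lerD //.
    by rewrite distrC ltW.
  by rewrite lerDl sumr_ge0.
have [r /= r0 hr] := (nbhs_ballP _ _).1 (filter_forall _ near_i).
exists (n%:R * M), (r / 2); split => //.
- by rewrite mulr_ge0.
- by rewrite divr_gt0.
move=> x y xr yr.
pose z (k : nat) : 'rV[R]_n := \row_(j < n) if (j < k)%N then x 0 j else y 0 j.
have zr k : `|z k| <= r / 2.
  apply: mx_norm_le => [|i j]; first by rewrite divr_ge0 // ltW.
  rewrite ord1 mxE; case: ifP => _.
    by apply: le_trans xr; exact: mx_coord_le.
  by apply: le_trans yr; exact: mx_coord_le.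
have -> : x = z n by apply/rowP => j; rewrite mxE ltn_ord.
have -> : y = z 0 by apply/rowP => j; rewrite mxE ltn0.
have xyE : `|z n - z 0| = `|x - y|.
  by congr `|_ - _|; apply/rowP => j; rewrite mxE ?ltn_ord ?ltn0.
rewrite xyE -(telescope_sumr (fun k => g (z k))) //.
apply: (le_trans (ler_norm_sum _ _ _)); rewrite big_mkord.
apply: le_trans (_ : \sum_(i < n) M * `|x - y| <= _); last first.
  by rewrite sumr_const card_ord -mulrA mulr_natl.
apply: ler_sum => i _.
(* [v] is [z i] with its i-th coordinate set to 0, so that [z i] and [z i.+1] lie on the line
   through [v] in direction [e]. *)
pose e : 'rV[R]_n := delta_mx 0 i; pose v := z i - y 0 i *: e.
have v1 : z i.+1 = x 0 i *: e + v.
  apply/rowP => j; rewrite !mxE ltnS eqxx /=.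
  have [->|/eqP ij] := eqVneq j i; first by rewrite leqnn ltnn /= !mulr1 subrr addr0.
  have /negPf ijn : (j : nat) != i by apply/eqP => /ord_inj.
  by rewrite leq_eqVlt ijn /= !mulr0 add0r subr0.
have v0 : z i = y 0 i *: e + v by rewrite /v addrC subrK.
rewrite v1 {1}v0; apply: (@le_trans _ _ (M * `|x 0 i - y 0 i|)); last first.
  by rewrite ler_wpM2l // (le_trans _ (mx_coord_le (x - y) 0 i)) // !mxE.
apply: lipschitz_on_line => [|s hs]; first by case: (dg i).
apply: hr; rewrite -ball_normE /ball_ /= sub0r normrN.
apply: le_lt_trans (_ : _ <= r / 2) _; last by lra.
apply: mx_norm_le => [|i0 j]; first by rewrite divr_ge0 // ltW.
rewrite ord1 !mxE eqxx /=.
have [->|/eqP ij] := eqVneq j i.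
  rewrite ltnn /= !mulr1 subrr addr0 (le_trans hs) // ge_max.
  by rewrite (le_trans (mx_coord_le _ _ _) xr) (le_trans (mx_coord_le _ _ _) yr).
by rewrite !mulr0 subr0 add0r; have := le_trans (mx_coord_le (z i) 0 j) (zr i); rewrite mxE.
Qed.

(** [[lipschitz g x | x in N]] states that all large enough constants work, so one of them can be
    taken to be at least 1. *)
Lemma lipschitz_onP (R : realType) (V W : normedModType R) (g : V -> W) (N : set V) :
  [lipschitz g x | x in N] ->
  exists2 L : R, 1 <= L & forall x y, N x -> N y -> `|g x - g y| <= L * `|x - y|.
Proof.
move=> gN.
have [L [L1 gL]] : exists L : R, 1 <= L /\ L.-lipschitz_N g.
  have /filter_ex : \forall M \near +oo, 1 <= M /\ M.-lipschitz_N g.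
    near=> M; split; first by near: M; exact: nbhs_pinfty_ge.
    by near: M; exact: gN.
  by [].
by exists L => // x y Nx Ny; exact: (gL (x, y)).
Unshelve. all: by end_near. Qed.

Lemma locally_lipschitz_continuous (R : realType) (n m : nat)
    (f : 'rV[R]_n -> 'rV[R]_m -> 'rV[R]_n) :
  locally_lipschitz f -> continuous (fun z => f z.1 z.2).
Proof.
move=> fl z; have [N zN /lipschitz_onP[L L1 fL]] := fl z.
have L0 : 0 < L by exact: lt_le_trans L1.
apply/cvgrPdist_lt => e e0.
have Nz : N z by exact: nbhs_singleton.
have eL : 0 < e / L by rewrite divr_gt0.
have := nbhsx_ballx z _ eL.
apply: filterS2 zN => y Ny; rewrite -ball_normE /= => zy.
by apply: le_lt_trans (fL _ _ Nz Ny) _; rewrite mulrC -ltr_pdivlMr.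
Qed.

Definition field_lipschitz (R : realType) (n m : nat)
    (f : 'rV[R]_n -> 'rV[R]_m -> 'rV[R]_n) (L r : R) : Prop :=
  forall x y u v c, `|x| <= r -> `|y| <= r -> `|u| <= r -> `|v| <= r ->
    `|x - y| <= c -> `|u - v| <= c -> `|f x u - f y v| <= L * c.

Definition feedback_lipschitz (R : realType) (n m : nat)
    (kappa : 'I_m -> 'rV[R]_n -> R) (L r : R) : Prop :=
  forall k x y, `|x| <= r -> `|y| <= r -> `|kappa k x - kappa k y| <= L * `|x - y|.

Lemma local_lipschitz_constants (R : realType) (n m : nat)
    (f : 'rV[R]_n -> 'rV[R]_m -> 'rV[R]_n) (kappa : 'I_m -> 'rV[R]_n -> R) (b : R) :
  0 < b -> locally_lipschitz f -> (forall i, Ck 1 (kappa i)) ->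
  exists L r, [/\ 1 <= L, 0 < r, r <= b, field_lipschitz f L r & feedback_lipschitz kappa L r].
Proof.
move=> b0 fl kC.
have [N N0 /lipschitz_onP[Lf Lf1 fL]] := fl (0, 0).
have [rf /= rf0 rfN] := (nbhs_ballP _ _).1 N0.
have /choice[g gP] : forall k : 'I_m, exists Lr : R * R, [/\ 0 <= Lr.1, 0 < Lr.2 &
    forall x y, `|x| <= Lr.2 -> `|y| <= Lr.2 ->
      `|kappa k x - kappa k y| <= Lr.1 * `|x - y|].
  by move=> k; have [L [r ?]] := C1_lipschitz_near0 (kC k); exists (L, r).
pose L := Lf + \sum_k (g k).1.
pose r := \big[Num.min/Num.min b (rf / 2)]_k (g k).2.
have sum0 : 0 <= \sum_k (g k).1 by apply: sumr_ge0 => k _; case: (gP k).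
have rb : r <= Num.min b (rf / 2) by exact: bigmin_le_id.
have rk k : r <= (g k).2 by exact: bigmin_le.
have Lk k : (g k).1 <= L.
  rewrite /L (bigD1 k) //= addrCA lerDl addr_ge0 ?(le_trans _ Lf1) //.
  by apply: sumr_ge0 => j _; case: (gP j).
exists L, r; split.
- by rewrite (le_trans Lf1) // lerDl.
- by apply: lt_bigmin => [|k _]; [rewrite lt_min b0 divr_gt0 | case: (gP k)].
- by rewrite (le_trans rb) // ge_min lexx.
- move=> x y u v c xr yr ur vr xyc uvc.
  have c0 : 0 <= c by apply: le_trans xyc.
  have rr : r < rf by rewrite (le_lt_trans rb) // gt_min; apply/orP; right; lra.
  have inN (x' : 'rV[R]_n) (u' : 'rV[R]_m) : `|x'| <= r -> `|u'| <= r -> N (x', u').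
    move=> x'r u'r; apply: rfN.
    by split; rewrite -ball_normE /= sub0r normrN (le_lt_trans _ rr).
  apply: (le_trans (fL (x, u) (y, v) (inN _ _ xr ur) (inN _ _ yr vr))).
  apply: (@le_trans _ _ (Lf * c)); last by rewrite ler_wpM2r // lerDl.
  rewrite ler_wpM2l ?(le_trans _ Lf1) //.
  by rewrite prod_normE /= ge_max xyc uvc.
- move=> k x y xr yr; have [_ _ h] := gP k.
  apply: (le_trans (h x y (le_trans xr (rk k)) (le_trans yr (rk k)))).
  by rewrite ler_wpM2r.
Qed.

(** * Differential and integral forms *)

Lemma cvg_mx_coord (R : realType) (T : Type) (F : set_system T) (FF : Filter F)
    (p q : nat) (M : T -> 'M[R]_(p, q)) (l : 'M[R]_(p, q)) :
  (forall i j, M x i j @[x --> F] --> l i j) -> M @ F --> l.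
Proof.
move=> h; apply/cvgrPdist_le => e e0.
have H (i : 'I_p) : \forall x \near F, forall j, `|l i j - M x i j| <= e.
  have hj (j : 'I_q) : \forall x \near F, `|l i j - M x i j| <= e.
    by move/cvgrPdist_le : (h i j) => /(_ _ e0).
  exact: (filter_forall _ hj).
apply: filterS (filter_forall _ H) => x hx.
by apply: mx_norm_le => [|i j]; [exact: ltW | rewrite !mxE; exact: hx].
Qed.

Lemma within_interior_continuous (R : realType) (W : topologicalType) (g : R -> W)
    (a b x : R) :
  {within `[a, b], continuous g} -> a < x < b -> {for x, continuous g}.
Proof.
move=> gc axb; have gc' : {within `]a, b[, continuous g}.
  by apply: continuous_subspaceW gc; exact: subset_itv_oo_cc.
move: gc'; rewrite continuous_open_subspace; last exact: interval_open.
by move=> /(_ x); apply; rewrite inE /= in_itv.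
Qed.

Lemma is_derive_vintegral (R : realType) (n : nat) (T : R) (G : R -> 'rV[R]_n) :
  {within `[0, T], continuous G} ->
  forall s : R, 0 < s < T ->
  is_derive s (1 : R) (fun t => vintegral `[0, t] G) (G s).
Proof.
move=> Gc s /andP[s0 sT]; apply: is_derive_mx => i j; rewrite ord1.
have Gjc : {within `[0, T], continuous (fun x => G x 0 j)}.
  apply: (@within_continuous_comp _ _ _ _ G (fun M : 'rV[R]_n => M 0 j)) => // M _.
  exact: coord_continuous.
have Gi : (@lebesgue_measure R).-integrable `[0, T] (EFin \o (fun x => G x 0 j)).
  by apply: continuous_compact_integrable => //; exact: segment_compact.
have cs : {for s, continuous (fun x => G x 0 j)}.
  by apply: within_interior_continuous Gjc _; rewrite s0 sT.
have [d1 d2] := continuous_FTC1_closed sT Gi s0 cs.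
have -> : (fun x => vintegral `[0, x] G 0 j) =
    (fun x => \int[@lebesgue_measure R]_(t in `[0, x]) G t 0 j).
  by apply/funext => x; rewrite mxE.
split; [exact: d1 | by rewrite -derive1E].
Qed.

Lemma vintegral_set1 (R : realType) (n : nat) (a : R) (G : R -> 'rV[R]_n) :
  vintegral `[a, a] G = 0.
Proof. by apply/rowP => j; rewrite !mxE set_itv1 Rintegral_set1. Qed.

(** Brings the closed loop, given by derivatives, into the integral form of [caratheodory_solution]
    to which input-to-state stability applies. *)
Lemma vintegral_is_derive (R : realType) (n : nat) (T : R) (X G : R -> 'rV[R]_n) :
  {within `[0, T], continuous X} -> {within `[0, T], continuous G} ->
  (forall s : R, 0 < s < T -> is_derive s (1 : R) X (G s)) ->
  forall t, 0 <= t <= T -> X t = X 0 + vintegral `[0, t] G.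
Proof.
move=> Xc Gc dX t /andP[]; rewrite le_eqVlt => /predU1P[<- _|t0 tT].
  by rewrite vintegral_set1 addr0.
have sub : `[0, t] `<=` `[0, T].
  by move=> x /=; rewrite !in_itv /= => /andP[-> /le_trans]; apply.
have coordc (Y : R -> 'rV[R]_n) j : {within `[0, T], continuous Y} ->
    {within `[0, t], continuous (fun x => Y x 0 j)}.
  move=> Yc.
  apply: (@within_continuous_comp _ _ _ _ Y (fun M : 'rV[R]_n => M 0 j)) => [M _|].
    exact: coord_continuous.
  exact: continuous_subspaceW Yc.
have dXj (j : 'I_n) (s : R) : 0 < s < t -> is_derive s (1 : R) (fun x => X x 0 j) (G s 0 j).
  move=> /andP[s0 st]; apply: is_derive_coord; apply: dX.
  by rewrite s0 (lt_le_trans st).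
apply/rowP => j; rewrite !mxE /Rintegral.
rewrite (@continuous_FTC2 R (fun x => G x 0 j) (fun x => X x 0 j)) //=.
- by rewrite addrC subrK.
- exact: coordc.
- have /(continuous_within_itvP _ t0)[_ h1 h2] := coordc _ j Xc.
  by split => // s; rewrite in_itv /= => /(dXj j)[].
- by move=> s; rewrite in_itv /= => /(dXj j) ds; rewrite derive1E derive_val.
Qed.

Lemma within_continuous_field (R : realType) (n m : nat)
    (f : 'rV[R]_n -> 'rV[R]_m -> 'rV[R]_n) (A : set R) (y : R -> 'rV[R]_n)
    (u : R -> 'rV[R]_m) :
  locally_lipschitz f -> {within A, continuous y} -> {within A, continuous u} ->
  {within A, continuous (fun s => f (y s) (u s))}.
Proof.
move=> /locally_lipschitz_continuous fc yc uc x.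
apply: (@cvg_comp2 (subspace A) _ _ _ _ (nbhs (y x)) (nbhs (u x)) _ _ _ _ y u f).
- exact: yc.
- exact: uc.
- exact: (fc (y x, u x)).
Qed.

Lemma within_continuous_mixed_input (R : realType) (n m i : nat)
    (kappa : 'I_m -> 'rV[R]_n -> R) (A : set R) (y : R -> 'rV[R]_n)
    (w : R -> 'rV[R]_(m - i)) :
  (forall k, continuous (kappa k)) ->
  {within A, continuous y} -> {within A, continuous w} ->
  {within A, continuous (fun s => mixed_input kappa (y s) (w s))}.
Proof.
move=> kc yc wc x; apply: cvg_mx_coord => i0 k; rewrite ord1 mxE.
under eq_fun do rewrite mxE.
case: ifP => ki.
  by apply: (@cvg_comp _ _ _ y (kappa k) _ (nbhs (y x))); [exact: yc | exact: kc].
case: insub => [l|] /=; last exact: cvg_cst.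
by apply: (@cvg_comp _ _ _ w (fun M : 'rV[R]_(m - i) => M 0 l) _ (nbhs (w x)));
  [exact: wc | exact: coord_continuous].
Qed.

(** Differentiates the integral equation, as [gronwall] speaks of derivatives. The integrand is
    continuous because [maps_C1] makes the predictor itself continuous. *)
Lemma predictor_ode (R : realType) (n m : nat) (f : 'rV[R]_n -> 'rV[R]_m -> 'rV[R]_n)
    (kappa : 'I_m -> 'rV[R]_n -> R) (P : operators R n m) (i : nat) Q
    (V : R -> 'rV[R]_(m - i)) phi :
  locally_lipschitz f -> (forall k, continuous (kappa k)) ->
  predictor_operators f kappa P -> (i < m)%N -> C1_on `[0, 1] V -> 0 <= phi ->
  [/\ {within `[0, 1], continuous (P i Q V phi)}, P i Q V phi 0 = Q &
    forall s : R, 0 < s < 1 -> is_derive s (1 : R) (P i Q V phi)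
      (phi *: f (P i Q V phi s) (mixed_input kappa (P i Q V phi s) (V s)))].
Proof.
move=> fl kc [PC Pe] im VC phi0; set y := P i Q V phi.
have yc : {within `[0, 1], continuous y} by case: (PC i Q V phi im VC phi0).
pose G s := f (y s) (mixed_input kappa (y s) (V s)).
have ye s : s \in `[0, 1] -> y s = Q + phi *: vintegral `[0, s] G by exact: Pe.
have Gc : {within `[0, 1], continuous G}.
  apply: within_continuous_field => //; apply: within_continuous_mixed_input => //.
  by case: VC.
split => //.
  by rewrite ye ?in_itv /= ?lexx ?ler01 // vintegral_set1 scaler0 addr0.
move=> s s01; have dI := is_derive_vintegral Gc s01.
have nearE : \forall t \near s, Q + phi *: vintegral `[0, t] G = y t.
  have : \forall t \near s, t \in `]0, 1[ by apply: near_in_itvoo; rewrite in_itv.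
  apply: filterS => t; rewrite in_itv /= => /andP[t0 t1].
  by rewrite ye // in_itv /= !ltW.
apply: near_eq_is_derive nearE _.
by apply: is_derive_eq; rewrite add0r.
Qed.

Lemma within_comp (T U V : topologicalType) (A : set T) (B : set U) (h : T -> U)
    (g : U -> V) :
  {within A, continuous h} -> (forall x, A x -> B (h x)) ->
  {within B, continuous g} -> {within A, continuous (fun x => g (h x))}.
Proof.
move=> /subspace_continuousP hc AB /subspace_continuousP gc.
apply/subspace_continuousP => x Ax N gN.
have H : nbhs x [set y | A y -> B (h y) -> N (g (h y))].
  exact: (hc x Ax _ (gc (h x) (AB x Ax) _ gN)).
change (nbhs x [set y | A y -> N (g (h y))]).
by apply: filterS H => y /= Hy Ay; exact: (Hy Ay (AB y Ay)).
Qed.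

Lemma affine_continuous (R : realType) (a b : R) : continuous (fun x : R => a + b * x).
Proof.
by move=> x; apply: cvgD; [exact: cvg_cst | apply: cvgM; [exact: cvg_cst | exact: cvg_id]].
Qed.

Lemma is_derive_affine (R : realType) (p q : nat) (M : R -> 'M[R]_(p, q)) (a b s : R)
    (dM : 'M[R]_(p, q)) :
  is_derive (a + b * s) (1 : R) M dM ->
  is_derive s (1 : R) (fun x => M (a + b * x)) (b *: dM).
Proof.
move=> dMs; apply: is_derive_mx => i j; rewrite mxE mulrC.
have d1 : is_derive s (1 : R) (fun x : R => a + b * x) b.
  by apply: is_derive_eq; rewrite add0r mul1r -[b%:A]/(b * 1) mulr1.
have dij := is_derive_coord i j dMs.
exact: (@is_derive1_comp R (fun x => M x i j) (fun x : R => a + b * x) s _ _ dij d1).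
Qed.

Lemma C1_on_row_affine (R : realType) (p : nat) (g : 'I_p -> R -> R) (d a : 'I_p -> R) (b : R) :
  0 <= b -> (forall l, C1_on `[d l, +oo[ (g l : R -> R^o)) -> (forall l, d l <= a l) ->
  C1_on `[0, 1] (fun x => \row_l g l (a l + b * x)).
Proof.
move=> b0 gC da.
have inA l x : 0 <= x -> d l <= a l + b * x.
  by move=> x0; rewrite (le_trans (da l)) // lerDl mulr_ge0.
have affc A l : {within A, continuous (fun x : R => a l + b * x)}.
  by apply: continuous_subspaceT; exact: affine_continuous.
have comp (h : R -> R) l : {within `[d l, +oo[, continuous h} ->
    {within `[0, 1], continuous (fun x => h (a l + b * x))}.
  move=> hc; apply: within_comp hc => // x /=.
  by rewrite !in_itv /= andbT => /andP[x0 _]; exact: inA.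
split.
  move=> x; apply: cvg_mx_coord => i l; rewrite mxE.
  rewrite (_ : (fun y => _) = (fun y => g l (a l + b * y))); last first.
    by apply/funext => y; rewrite mxE.
  by apply: comp; case: (gC l).
have /choice[g' g'P] : forall l, exists g' : R -> R, {within `[d l, +oo[, continuous g'} /\
    forall x, (`[d l, +oo[)^° x -> is_derive x (1 : R) (g l) (g' x).
  by move=> l; have [_ [g' g'c dg]] := gC l; exists g'.
exists (fun x => \row_l (b * g' l (a l + b * x))).
  move=> x; apply: cvg_mx_coord => i l; rewrite mxE.
  rewrite (_ : (fun y => _) = (fun y => b * g' l (a l + b * y))); last first.
    by apply/funext => y; rewrite mxE.
  by apply: cvgM; [exact: cvg_cst | apply: comp; case: (g'P l)].
move=> x; rewrite interior_itv_bnd /= in_itv /= => /andP[x0 x1].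
apply: is_derive_mx => i l; rewrite ord1 mxE.
rewrite (_ : (fun y => _) = (fun y => g l (a l + b * y))); last first.
  by apply/funext => y; rewrite mxE.
have d1 : is_derive x (1 : R) (fun x : R => a l + b * x) b.
  by apply: is_derive_eq; rewrite add0r mul1r -[b%:A]/(b * 1) mulr1.
(* [b = 0] occurs for equal delays. The argument of [g l] is then fixed and may be the endpoint
   [d l], where no derivative is available; but the composition is constant. *)
move: b0; rewrite le_eqVlt => /predU1P[b0|b0].
  rewrite -b0 mul0r (_ : (fun y => _) = cst (g l (a l))); last first.
    by apply/funext => y; rewrite mul0r addr0.
  exact: is_derive_cst.
rewrite mulrC.
apply: (@is_derive1_comp R (g l) (fun x : R => a l + b * x) x _ _ _ d1).
have [_] := g'P l; apply; rewrite interior_itv_bndy /= in_itv /= andbT.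
by rewrite (le_lt_trans (da l)) // ltrDl mulr_gt0.
Qed.

(** * Comparison functions *)

Lemma class_K_le (R : realType) (a : R -> R) x y :
  class_K a -> 0 <= x -> x <= y -> a x <= a y.
Proof.
move=> [_ ainc _] x0; rewrite le_eqVlt => /predU1P[-> //|xy].
by rewrite ltW // ainc.
Qed.

Lemma class_K_ge0 (R : realType) (a : R -> R) x : class_K a -> 0 <= x -> 0 <= a x.
Proof. by move=> aK x0; have [_ _ a0] := aK; rewrite -[leLHS]a0; exact: class_K_le. Qed.

Lemma class_K_scale (R : realType) (a : R -> R) (c : R) :
  class_K a -> 0 < c -> class_K (fun r => a (c * r)).
Proof.
move=> [ac ai a0] c0; split; last by rewrite mulr0.
- apply: (within_comp _ _ ac) => [|x /=].
    by apply: continuous_subspaceT => x; apply: cvgM; [exact: cvg_cst | exact: cvg_id].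
  by rewrite !in_itv /= !andbT => x0; rewrite mulr_ge0 // ltW.
- by move=> r s r0 rs; apply: ai; rewrite ?mulr_ge0 ?ltr_pM2l // ltW.
Qed.

Lemma class_KD (R : realType) (a b : R -> R) :
  class_K a -> class_K b -> class_K (fun r => a r + b r).
Proof.
move=> [ac ai a0] [bc bi b0]; split; last by rewrite a0 b0 addr0.
- by move=> x; apply: cvgD; [exact: ac | exact: bc].
- by move=> r s r0 rs; rewrite ltrD ?ai ?bi.
Qed.

Lemma class_K_linear (R : realType) (c : R) : 0 < c -> class_K (fun r : R => c * r).
Proof.
move=> c0; split; last by rewrite mulr0.
- by apply: continuous_subspaceT => x; apply: cvgM; [exact: cvg_cst | exact: cvg_id].
- by move=> r s _ rs; rewrite ltr_pM2l.
Qed.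

Lemma class_K_mull (R : realType) (c : R) (a : R -> R) :
  0 < c -> class_K a -> class_K (fun r => c * a r).
Proof.
move=> c0 [ac ai a0]; split; last by rewrite a0 mulr0.
- by move=> x; apply: cvgM; [exact: cvg_cst | exact: ac].
- by move=> r s r0 rs; rewrite ltr_pM2l // ai.
Qed.

Lemma class_K_small (R : realType) (a : R -> R) (e : R) : class_K a -> 0 < e ->
  exists2 d, 0 < d & forall x, 0 <= x <= d -> a x < e.
Proof.
move=> aK e0; have [/subspace_continuousP ac _ a0] := aK.
have := ac 0; rewrite /= in_itv /= lexx => /(_ isT) /cvgrPdist_lt /(_ e e0).
rewrite near_withinE /from_subspace a0 => /nbhs_ballP[d /= d0 hd].
exists (d / 2); first by rewrite divr_gt0.
move=> x /andP[x0 xd]; have := hd x; rewrite /ball /= sub0r normrN ger0_norm //.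
rewrite in_itv /= x0 sub0r normrN ger0_norm ?class_K_ge0 // => h.
by apply: h => //; lra.
Qed.

(** The linear lower bound gives [a (y / c) >= y], and the intermediate value theorem does the rest.
    It ensures that [K_inv] never returns its default value where it is used. *)
Lemma class_K_range (R : realType) (a : R -> R) (c y : R) : class_K a -> 0 < c ->
  (forall r, 0 <= r -> c * r <= a r) -> 0 <= y -> in_K_range a y.
Proof.
move=> [ac _ a0] c0 ca y0.
have yc : 0 <= y / c by rewrite divr_ge0 // ltW.
have ay : y <= a (y / c) by apply: le_trans (ca _ yc); rewrite mulrC divfK // gt_eqF.
have ac' : {within `[0, y / c], continuous a}.
  by apply: continuous_subspaceW ac => x /=; rewrite !in_itv /= andbT => /andP[].
have [|x] := @IVT R a 0 (y / c) y yc ac'.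
  by rewrite a0 (min_idPl _) ?(max_idPr _) ?y0 ?ay // (le_trans y0).
by rewrite in_itv /= => /andP[x0 _] ax; exists x.
Qed.

Lemma K_invP (R : realType) (a : R -> R) (y : R) : in_K_range a y ->
  0 <= K_inv a y /\ a (K_inv a y) = y.
Proof.
move=> [r r0 ar]; have := @xgetPex _ 0 [set r | 0 <= r /\ a r = y].
by apply; exists r.
Qed.

(** The shape of the final beta. The input-to-state estimate starts only at time T, whence the
    shifted time clipped at 0. Before T there is only a bound proportional to r, and it is covered
    by [r * expR (T - t) >= r], a term that still decays. *)
Lemma class_KL_delay (R : realType) (b : R -> R -> R) (A c T : R) :
  class_KL b -> 0 < A -> 0 < c -> 0 <= T ->
  class_KL (fun r t => A * (b (c * r) (Num.max 0 (t - T)) + r * expR (T - t))).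
Proof.
move=> [bc bK bd b0] A0 c0 T0.
have m0 t : 0 <= Num.max 0 (t - T) by rewrite le_max lexx.
split.
- have ec : continuous (fun z : R * R => expR (T - z.2)).
    move=> z; apply: (@continuous_comp _ _ _ (fun z : R * R => T - z.2) expR).
      by apply: cvgB; [exact: cvg_cst | exact: cvg_snd].
    exact: continuous_expR.
  have h : {within `[0, +oo[ `*` `[0, +oo[, continuous
      (fun z : R * R => b (c * z.1) (Num.max 0 (z.2 - T)))}.
    pose sh (z : R * R) := (c * z.1, Num.max 0 (z.2 - T)).
    have shc : {within `[0, +oo[ `*` `[0, +oo[, continuous sh}.
      apply: continuous_subspaceT => z.
      apply: (@cvg_pair _ _ _ _ (nbhs (c * z.1)) (nbhs (Num.max 0 (z.2 - T)))).
        by apply: cvgM; [exact: cvg_cst | exact: cvg_fst].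
      apply: (@cvg_comp2 _ _ _ _ _ (nbhs (0 : R)) (nbhs (z.2 - T)) _ _ _ _
        (fun=> 0) (fun z : R * R => z.2 - T) Num.max).
      + exact: cvg_cst.
      + by apply: cvgB; [exact: cvg_snd | exact: cvg_cst].
      + exact: (@max_continuous _ R (0 : R, z.2 - T)).
    have shin (z : R * R) : (`[0, +oo[ `*` `[0, +oo[) z -> (`[0, +oo[ `*` `[0, +oo[) (sh z).
      move=> [/= z1 z2]; move: z1 z2; rewrite !in_itv /= !andbT => z1 z2.
      by split; rewrite /= ?in_itv /= ?andbT // mulr_ge0 // ltW.
    exact: (within_comp shc shin bc).
  move=> z; apply: cvgM; first exact: cvg_cst.
  apply: cvgD; first exact: h.
  apply: (@continuous_subspaceT _ _ _ (fun z : R * R => z.1 * expR (T - z.2))) => y.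
  by apply: cvgM; [exact: cvg_fst | exact: ec].
- move=> t t0; apply: class_K_mull => //; apply: class_KD.
    by apply: (class_K_scale (bK _ (m0 t))).
  have := class_K_linear (expR_gt0 (T - t)).
  by congr class_K; apply/funext => r; rewrite mulrC.
- move=> r s t r0 s0 st; rewrite ler_pM2l // lerD //.
    apply: bd => //; first by rewrite mulr_ge0 // ltW.
    by rewrite ge_max m0 /= le_max lerD2r st orbT.
  by rewrite ler_wpM2l // ler_expR lerD2l lerN2.
- move=> r r0; rewrite -(mulr0 A); apply: cvgM; first exact: cvg_cst.
  rewrite -[0 in X in _ --> X]addr0; apply: cvgD.
    have cr : 0 <= c * r by rewrite mulr_ge0 // ltW.
    have := b0 _ cr; apply: cvg_comp => S [M [Mr MS]].
    exists (Num.max M 0 + T); split; first by rewrite num_real.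
    move=> x Mx; apply: MS.
    by rewrite lt_max ltrBrDr (le_lt_trans _ Mx) ?orbT // lerD2r le_max lexx.
  rewrite -(mulr0 r); apply: cvgM; first exact: cvg_cst.
  rewrite (_ : (fun t => _) = (fun t => expR T * expR (- t))); last first.
    by apply/funext => t; rewrite -expRD.
  rewrite -(mulr0 (expR T)); apply: cvgM; first exact: cvg_cst.
  exact: cvgr_expR.
Qed.

(** * Stability of one predictor stage *)

(** The [sup] of an unbounded set is a default value, so a bound on it controls the error pointwise
    only once the error is known to be bounded. That follows from continuity on [[0, 1]]. *)
Lemma uniform_error_at (R : realType) (n m : nat) (P Phat : operators R n m)
    (XX : set 'rV[R]_n) (UU : set R) (Phi : set R) (eps : R) (i : nat) Q
    (V : R -> 'rV[R]_(m - i)) phi :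
  maps_C1 P -> maps_C1 Phat -> uniform_error P Phat XX UU Phi eps ->
  (i < m)%N -> XX Q -> C1_on `[0, 1] V ->
  (forall s, s \in `[0, 1] -> forall l, UU (V s 0 l)) -> Phi phi -> 0 <= phi ->
  forall s, s \in `[0, 1] -> enorm (P i Q V phi s - Phat i Q V phi s) < eps.
Proof.
move=> PC PhC err im XQ VC UV Pphi phi0 s s01.
apply: le_lt_trans (err _ _ _ _ im XQ VC UV Pphi).
have [Pc _] := PC _ Q _ _ im VC phi0; have [Phc _] := PhC _ Q _ _ im VC phi0.
pose h t := P i Q V phi t - Phat i Q V phi t.
have hc : {within `[0, 1], continuous (fun t => `|h t|)}.
  move=> x; apply: cvg_norm; apply: cvgB; [exact: Pc | exact: Phc].
have [c c01 hmax] := EVT_max ler01 hc.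
have ub : has_ubound [set enorm (h s) | s in `[0, 1]].
  exists (n%:R * `|h c|) => _ [t /= t01 <-].
  by apply: (le_trans (enorm_le_norm _)); rewrite ler_wpM2l //; exact: hmax.
by apply: (ub_le_sup ub); exists s.
Qed.

Lemma mixed_input_tail (R : realType) (n m : nat) (kappa : 'I_m -> 'rV[R]_n -> R)
    (i : nat) (k : 'I_m) : (i <= k)%N ->
  exists l : 'I_(m - i), tail_ord l = k /\
    forall x (w : 'rV[R]_(m - i)), mixed_input kappa x w 0 k = w 0 l.
Proof.
move=> ik; have h : (k - i < m - i)%N by rewrite ltn_sub2r // (leq_ltn_trans ik).
exists (Ordinal h); split; first by apply/val_inj => /=; rewrite subnKC.
by move=> x w; rewrite mxE ltnNge ik /= insubT.
Qed.

Lemma tail_ord_ge (m i : nat) (l : 'I_(m - i)) : (i <= tail_ord l)%N.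
Proof. exact: leq_addr. Qed.

Section step.
Variables (R : realType) (n m : nat) (f : 'rV[R]_n -> 'rV[R]_m -> 'rV[R]_n)
  (kappa : 'I_m -> 'rV[R]_n -> R) (P : operators R n m) (L r T : R).
Hypotheses (fl : locally_lipschitz f) (kc : forall k, continuous (kappa k))
  (Pp : predictor_operators f kappa P) (L1 : 1 <= L) (r0 : 0 < r) (T0 : 0 <= T)
  (fL : field_lipschitz f L r) (kL : feedback_lipschitz kappa L r).

Arguments P : clear implicits.

(** Gronwall factor on [[0, 1]]. In the rate [T * L ^+ 2] one [L] comes from [f], the other from the
    feedbacks inside it; the inhomogeneous term [T * L * c] is rounded up to the same rate using
    [1 <= L]. *)
Definition growth : R := (1 + T * L ^+ 2) * expR (T * L ^+ 2).

(** The reference trajectory [x] with input [w] is left arbitrary because two of them are needed: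
    the plant itself, and the zero solution. *)
Lemma predictor_stability (i : nat) Q (V : R -> 'rV[R]_(m - i)) phi
    (x : R -> 'rV[R]_n) (w : R -> 'rV[R]_m) (c : R) :
  (i < m)%N -> C1_on `[0, 1] V -> 0 <= phi <= T ->
  (forall j : 'I_m, (j < i)%N -> kappa j 0 = 0) ->
  {within `[0, 1], continuous x} ->
  (forall s : R, 0 < s < 1 -> is_derive s (1 : R) x (phi *: f (x s) (w s))) ->
  (forall s, 0 <= s <= 1 -> `|x s| <= r / L / 2) ->
  (forall s, 0 <= s <= 1 -> `|w s| <= r) ->
  (forall s, 0 <= s <= 1 -> forall l, `|V s 0 l| <= r) ->
  (forall s, 0 <= s <= 1 -> forall j : 'I_m, (j < i)%N -> `|kappa j (x s) - w s 0 j| <= c) ->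
  (forall s, 0 <= s <= 1 -> forall l, `|V s 0 l - w s 0 (tail_ord l)| <= c) ->
  `|Q - x 0| < c -> growth * c <= r / L / 2 ->
  forall s, 0 <= s <= 1 -> `|P i Q V phi s - x s| < growth * c.
Proof.
move=> im VC /andP[phi0 phiT] k0 xc dx xr wr Vr kw Vw Qc cr.
have c0 : 0 < c by apply: le_lt_trans Qc.
have L0 : 0 < L by apply: lt_le_trans L1.
have rL : r / L <= r by rewrite ler_pdivrMr // ler_peMr // ltW.
have rL0 : 0 < r / L by rewrite divr_gt0.
have [yc y0 dy] := predictor_ode Q fl kc Pp im VC phi0.
set y := P i Q V phi in yc y0 dy *.
have TL0 : 0 <= T * L ^+ 2 by rewrite mulr_ge0 ?sqr_ge0.
have -> : growth * c = (c + T * L ^+ 2 * c * 1) * expR (T * L ^+ 2 * 1).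
  rewrite /growth !mulr1; ring.
apply: (@gronwall _ _ _ 1 (T * L ^+ 2) c (T * L ^+ 2 * c) (r / L / 2) (fun s => y s - x s)
  (fun s => phi *: (f (y s) (mixed_input kappa (y s) (V s))) - phi *: f (x s) (w s))) => //.
- by rewrite mulr_ge0 // ltW.
- by move=> s; apply: cvgB; [exact: yc | exact: xc].
- by move=> s s01; have := dy s s01; have := dx s s01 => ? ?; exact: is_deriveB.
- move=> s /andP[s0 s1] zs; rewrite -scalerBr normrZ ger0_norm //.
  have s01 : 0 <= s <= 1 by rewrite !ltW.
  have xs := xr s s01.
  have ys : `|y s| <= r / L.
    by rewrite -(subrK (x s) (y s)) (le_trans (ler_normD _ _)) //; lra.
  set z := `|y s - x s| in zs *.
  have z0 : 0 <= z by exact: normr_ge0.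
  have zLc : z <= L * z + c by rewrite ler_wpDr ?ler_peMl // ltW.
  (* The origin of the radius [r / L]: there the feedbacks, vanishing at 0, are at most r, so the
     input stays where [f] is Lipschitz. One half of [r / L] goes to [x], the other to the deviation
     from it. *)
  have kb (j : 'I_m) : (j < i)%N -> `|kappa j (y s)| <= r.
    move=> ji; have := @kL j (y s) 0; rewrite k0 // !subr0 normr0.
    move=> /(_ (le_trans ys rL) (ltW r0)) h; apply: (le_trans h).
    by rewrite mulrC -ler_pdivlMr.
  have : `|f (y s) (mixed_input kappa (y s) (V s)) - f (x s) (w s)| <= L * (L * z + c).
    apply: fL => //.
    + exact: le_trans rL.
    + by rewrite (le_trans xs) //; lra.
    + apply: mx_norm_le => [|i0 j]; [exact: ltW | rewrite ord1].
      have [ji|ij] := ltnP j i; first by rewrite mxE ji kb.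
      by have [l [_ ->]] := mixed_input_tail kappa ij; exact: Vr.
    + exact: wr.
    + apply: mx_norm_le => [|i0 j]; [by apply: le_trans zLc | rewrite ord1].
      rewrite mxE [X in _ + X]mxE.
      have [ji|ij] := ltnP j i.
        rewrite mxE ji -(subrK (kappa j (x s)) (kappa j (y s))) -addrA.
        rewrite (le_trans (ler_normD _ _)) // lerD //; last exact: kw.
        by apply: kL; [exact: le_trans rL | rewrite (le_trans xs) //; lra].
      have [l [<- ->]] := mixed_input_tail kappa ij.
      by rewrite (le_trans (Vw s s01 l)) // lerDr mulr_ge0 // ltW.
  set F := `|_| => FL; have F0 : 0 <= F by exact: normr_ge0.
  apply: (@le_trans _ _ (T * (L * (L * z + c)))); first by rewrite ler_pM.
  have : 0 <= T * (L * c * (L - 1)) by rewrite !mulr_ge0 ?subr_ge0 // ltW.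
  nra.
- by rewrite y0.
- by move: cr; rewrite /growth; apply: le_trans; rewrite le_eqVlt; apply/orP; left; apply/eqP; rewrite !mulr1; ring.
Qed.

End step.

(** * The closed loop *)

Section closed_loop.
Variables (R : realType) (n m : nat) (f : 'rV[R]_n -> 'rV[R]_m -> 'rV[R]_n)
  (kappa : 'I_m -> 'rV[R]_n -> R) (P Phat : operators R n m) (D : nat -> R)
  (XX : set 'rV[R]_n) (UU Phi : set R) (L r eps delta : R)
  (X : R -> 'rV[R]_n) (U : 'I_m -> R -> R).
Arguments P : clear implicits.
Arguments Phat : clear implicits.
Hypotheses (D0 : D 0%N = 0) (D1 : 0 < D 1%N)
  (Dle : forall i, (0 < i < m)%N -> D i <= D i.+1)
  (fl : locally_lipschitz f) (f00 : f 0 0 = 0) (kc : forall k, continuous (kappa k))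
  (Pp : predictor_operators f kappa P) (L1 : 1 <= L) (r0 : 0 < r)
  (fL : field_lipschitz f L r) (kL : feedback_lipschitz kappa L r)
  (PhC : maps_C1 Phat)
  (PhiD : forall i, (i < m)%N -> Phi (D i.+1 - D i))
  (err : uniform_error P Phat XX UU Phi eps)
  (rXX : forall x, `|x| <= r -> XX x) (rUU : forall u, `|u| <= r -> UU u)
  (cl : closed_loop_solution f kappa D Phat X U)
  (eps0 : 0 < eps) (delta0 : 0 <= delta).

(* [W t] is what enters the plant at time t, and [q i t], computed at time
   t - D i, predicts [X t]. *)
Definition input (t : R) : 'rV[R]_m := \row_i U i (t - D i.+1).
Definition prediction (i : nat) (t : R) : 'rV[R]_n :=
  approx_predictor Phat D X U i (t - D i).
(* The prediction error grows at most by this factor per stage. *)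
Definition gain : R := growth L (D m) * L + 1.
Notation W := input.
Notation q := prediction.
Notation phi i := (D i.+1 - D i).

Lemma delay_succ i : (i < m)%N -> D i <= D i.+1.
Proof. by case: i => [|i] im; [rewrite D0 ltW | exact: Dle]. Qed.

Lemma delay_le i j : (i <= j <= m)%N -> D i <= D j.
Proof.
elim: j => [|j IH] /andP[]; first by rewrite leqn0 => /eqP ->.
rewrite leq_eqVlt => /predU1P[-> //|ij jm].
by rewrite (le_trans (IH _)) ?delay_succ // -ltnS ij ltnW.
Qed.

Lemma delay_ge0 i : (i <= m)%N -> 0 <= D i.
Proof. by move=> im; rewrite -D0 delay_le. Qed.

Lemma delay_diff i : (i < m)%N -> 0 <= phi i <= D m.
Proof.
move=> im; rewrite subr_ge0 delay_succ //=.
by rewrite lerBlDr ler_wpDr ?delay_ge0 ?delay_le ?leqnn ?andbT // ltnW.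
Qed.

Lemma growth_ge1 : 1 <= growth L (D m).
Proof.
have h : 0 <= D m * L ^+ 2 by rewrite mulr_ge0 ?sqr_ge0 // delay_ge0.
rewrite /growth -[leLHS]mulr1 ler_pM //; first by rewrite lerDl.
by rewrite -expR0 ler_expR.
Qed.

Lemma gain_ge1 : 1 <= gain.
Proof.
by rewrite /gain lerDr mulr_ge0 ?(le_trans _ L1) ?(le_trans _ growth_ge1).
Qed.

Lemma gain_le i j : (i <= j)%N -> gain ^+ i <= gain ^+ j.
Proof. by move=> ij; rewrite ler_weXn2l // gain_ge1. Qed.

Lemma input_continuous : {within `[0, +oo[, continuous W}.
Proof.
have [_ UC _] := cl.
move=> x; apply: cvg_mx_coord => i k; rewrite mxE.
rewrite (_ : (fun y => _) = (fun y => U k (y - D k.+1))); last first.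
  by apply/funext => y; rewrite mxE.
have [Uc _] := UC k; move: x; apply: (within_comp _ _ Uc) => [|x /=].
  by apply: continuous_subspaceT => x; apply: cvgB; [exact: cvg_id | exact: cvg_cst].
by rewrite !in_itv /= !andbT => x0; rewrite lerBrDr addNr.
Qed.

Lemma state_continuous : {within `[0, +oo[, continuous X}.
Proof. by case: cl => [[]]. Qed.

Lemma state_derive (t : R) : 0 < t -> is_derive t (1 : R) X (f (X t) (W t)).
Proof. by case: cl => [[_ dX] _ _]; exact: dX. Qed.

Definition input_history (i : nat) (t x : R) : 'rV[R]_(m - i) :=
  \row_l W (t - phi i + phi i * x) 0 (tail_ord l).

(** In plant time the recursion becomes uniform: the prediction of [X t] starts from the previous
    stage's prediction of [X (t - phi i)], and its histories cover just the interval between these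
    two times. *)
Lemma predictionS i t :
  q i.+1 t = Phat i (q i (t - phi i)) (input_history i t) (phi i) 1.
Proof.
rewrite /prediction /=; have -> : t - D i.+1 = t - phi i - D i by ring.
congr (Phat _ _ _ _ _); apply/funext => x; apply/rowP => l.
rewrite !mxE /history /=; congr (U _ _); ring.
Qed.

Lemma input_history_C1 i t : (i < m)%N -> D i.+1 <= t -> C1_on `[0, 1] (input_history i t).
Proof.
move=> im Dt; have [_ UC _] := cl.
have -> : input_history i t = (fun x => \row_l U (tail_ord l)
    (t - phi i - D (tail_ord l).+1 + phi i * x)).
  by apply/funext => x; apply/rowP => l; rewrite !mxE; congr (U _ _); ring.
apply: (@C1_on_row_affine _ _ (fun l : 'I_(m - i) => U (tail_ord l))
  (fun l => - D (tail_ord l).+1)) => [||l].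
- by case/andP: (delay_diff im).
- by move=> l; exact: UC.
- by have := delay_ge0 (ltnW im); rewrite lerDr; lra.
Qed.

Lemma input_feedback (i : 'I_m) t : D i.+1 <= t -> W t 0 i = kappa i (q i.+1 t).
Proof. by move=> Dt; rewrite mxE; case: cl => _ _ -> //; rewrite subr_ge0. Qed.

(** Stability of the exact stage, plus [eps] for its neural replacement. The uniform error holds on
    [XX] and [UU] only, so the starting point and the histories are first placed in the ball of
    radius r. *)
Lemma prediction_step i t (x : R -> 'rV[R]_n) (w : R -> 'rV[R]_m) (c : R) :
  (i < m)%N -> D i.+1 <= t -> (forall j : 'I_m, (j < i)%N -> kappa j 0 = 0) ->
  {within `[0, 1], continuous x} ->
  (forall s : R, 0 < s < 1 -> is_derive s (1 : R) x (phi i *: f (x s) (w s))) ->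
  (forall s, 0 <= s <= 1 -> `|x s| <= r / L / 2) ->
  (forall s, 0 <= s <= 1 -> `|w s| <= r) ->
  (forall s, 0 <= s <= 1 -> forall l, `|input_history i t s 0 l| <= r) ->
  (forall s, 0 <= s <= 1 -> forall j : 'I_m, (j < i)%N -> `|kappa j (x s) - w s 0 j| <= c) ->
  (forall s, 0 <= s <= 1 -> forall l,
    `|input_history i t s 0 l - w s 0 (tail_ord l)| <= c) ->
  `|q i (t - phi i) - x 0| < c -> growth L (D m) * c <= r / L / 2 ->
  `|q i.+1 t - x 1| < growth L (D m) * c + eps.
Proof.
move=> im Dt k0 xc dx xr wr Vr kw Vw Qc cr.
have VC := input_history_C1 im Dt.
have c0 : 0 < c by apply: le_lt_trans Qc.
have L0 : 0 < L by exact: lt_le_trans L1.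
have rL : r / L <= r by rewrite ler_pdivrMr // ler_peMr // ltW.
have E1 := growth_ge1.
have i01 : 0 <= (1 : R) <= 1 by rewrite ler01 lexx.
have i00 : 0 <= (0 : R) <= 1 by rewrite ler01 lexx.
have := predictor_stability fl kc Pp L1 r0 (delay_ge0 (leqnn m)) fL kL im VC
  (delay_diff im) k0 xc dx xr wr Vr kw Vw Qc cr i01.
set Q := q i (t - phi i) in Qc *; set V := input_history i t in VC Vr Vw *.
have Qr : `|Q| <= r.
  have := xr 0 i00; rewrite -(subrK (x 0) Q) => x0r.
  have cE : c <= growth L (D m) * c by rewrite ler_peMl // ltW.
  by apply: (le_trans (ler_normD _ _)); lra.
have [PC _] := Pp; case/andP: (delay_diff im) => phi0 _.
have Ve s : s \in `[0, 1] -> forall l, UU (V s 0 l).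
  by rewrite in_itv /= => s01 l; apply: rUU; exact: Vr.
have s1 : (1 : R) \in `[0, 1] by rewrite in_itv.
have := uniform_error_at PC PhC err im (rXX Qr) VC Ve (PhiD im) phi0 s1.
move=> /(le_lt_trans (norm_le_enorm _)); rewrite predictionS -/Q -/V distrC => e1 e2.
rewrite -(subrK (P i Q V (phi i) 1) (Phat i Q V (phi i) 1)) -addrA.
apply: (le_lt_trans (ler_normD _ _)). lra.
Qed.

Lemma affine_in i t s : (i < m)%N -> D i.+1 <= t -> 0 <= s <= 1 ->
  D i <= t - phi i + phi i * s <= t.
Proof.
move=> im Dt /andP[s0 s1]; case/andP: (delay_diff im) => p0 _.
have h1 : 0 <= phi i * s by exact: mulr_ge0.
have h2 : 0 <= phi i * (1 - s) by rewrite mulr_ge0 // subr_ge0.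
move: h1 h2; set p := phi i * s; rewrite mulrBr mulr1 -/p => h1 h2.
by apply/andP; split; lra.
Qed.

(** The hypothesis of the continuous induction. Half of [r / L] is kept free for the prediction
    error. *)
Definition small_until (T : R) : Prop :=
  forall t, 0 <= t <= T -> `|X t| <= r / L / 2 /\ `|W t| <= r / L / 2.

Lemma prediction_error T : (forall k, kappa k 0 = 0) -> small_until T ->
  gain ^+ m * eps <= r / L / 2 ->
  forall i, (i <= m)%N -> forall t, D i <= t <= T -> `|q i t - X t| < gain ^+ i * eps.
Proof.
move=> k0 sT Gr.
have L0 : 0 < L by exact: lt_le_trans L1.
have rL : r / L <= r by rewrite ler_pdivrMr // ler_peMr // ltW.
have rL0 : 0 < r / L by rewrite divr_gt0.
have E1 := growth_ge1; have G1 := gain_ge1.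
have Ge i : (i <= m)%N -> gain ^+ i * eps <= r / L / 2.
  by move=> im; apply: le_trans Gr; rewrite ler_wpM2r ?gain_le // ltW.
elim/ltn_ind => -[_ _ t tT|i IH im t /andP[Dt tT]].
  by rewrite /prediction D0 /= subr0 subrr normr0 expr0 mul1r.
have iGe : 0 < gain ^+ i * eps by rewrite mulr_gt0 // exprn_gt0 // (lt_le_trans _ G1).
(* Earlier stages err by at most [gain ^+ i * eps], and passing through a feedback multiplies this
   by L. *)
pose c := L * (gain ^+ i * eps).
have c0 : 0 < c by rewrite mulr_gt0.
have cE : gain ^+ i.+1 * eps = growth L (D m) * c + gain ^+ i * eps.
  by rewrite exprS /c {1}/gain; ring.
have eG : eps <= gain ^+ i * eps by rewrite ler_peMl ?(ltW eps0) // exprn_ege1.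
apply: (@lt_le_trans _ _ (growth L (D m) * c + eps)); last by rewrite cE lerD2l.
have -> : X t = X (t - phi i + phi i * 1) by rewrite mulr1 subrK.
have tin s := affine_in im Dt (s := s).
have t0in s : 0 <= s <= 1 -> 0 <= t - phi i + phi i * s <= T.
  by move=> /tin /andP[h1 h2]; rewrite (le_trans (delay_ge0 (ltnW im)) h1) (le_trans h2).
apply: (@prediction_step i t (fun s => X (t - phi i + phi i * s))
  (fun s => W (t - phi i + phi i * s)) c im Dt) => //.
- apply: within_comp state_continuous => [|s /=].
    by apply: continuous_subspaceT; exact: affine_continuous.
  by rewrite !in_itv /= andbT => /t0in /andP[].
- move=> s /andP[s0 s1]; case/andP: (delay_diff im) => p0 _.
  move: p0; rewrite le_eqVlt => /predU1P[p0|p0].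
    rewrite -p0 scale0r (_ : (fun _ => _) = cst (X (t - 0))); last first.
      by apply/funext => y; rewrite mul0r addr0.
    exact: is_derive_cst.
  apply: is_derive_affine; apply: state_derive.
  apply: (@lt_le_trans _ _ (phi i * s)); first by rewrite mulr_gt0.
  rewrite lerDr subr_ge0 (le_trans _ Dt) // lerBlDr lerDl; exact: delay_ge0 (ltnW im).
- by move=> s /t0in /sT[].
- by move=> s /t0in /sT[_] h; apply: (le_trans h); lra.
- move=> s /t0in /sT[_] h l; rewrite mxE; apply: (le_trans (mx_coord_le _ _ _)).
  by apply: (le_trans h); lra.
(* For [j < i] the times involved are at least [D i >= D j.+1], so input j is already the feedback
   of stage [j.+1], to which the induction hypothesis applies at that time. *)
- move=> s s01 j ji; have /andP[h1 h2] := tin s s01.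
  have jm : (j < m)%N by [].
  have Dj : D j.+1 <= t - phi i + phi i * s.
    by rewrite (le_trans _ h1) // delay_le // ji ltnW.
  rewrite input_feedback //; set u := t - phi i + phi i * s in h1 h2 Dj *.
  have e1 : `|q j.+1 u - X u| < gain ^+ j.+1 * eps.
    by apply: IH => //; rewrite Dj (le_trans h2).
  have [Xu _] : `|X u| <= r / L / 2 /\ `|W u| <= r / L / 2 by apply: sT; exact: t0in.
  apply: (le_trans (kL _ _ _)).
  + by apply: (le_trans Xu); lra.
  + rewrite -(subrK (X u) (q _ _)); apply: (le_trans (ler_normD _ _)).
    by have := Ge j.+1 jm; lra.
  + rewrite /c ler_wpM2l ?(ltW L0) // distrC (le_trans (ltW e1)) //.
    by rewrite ler_wpM2r ?gain_le // ltW.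
- by move=> s _ l; rewrite mxE subrr normr0 ltW.
- rewrite mulr0 addr0; apply: (@lt_le_trans _ _ (gain ^+ i * eps)); last first.
    by rewrite /c ler_peMl // ltW.
  apply: IH => //; first exact: ltnW.
  have /andP[h1 h2] := tin 0 (andb_true_intro (conj (lexx 0) ler01)).
  by rewrite mulr0 addr0 in h1 h2; rewrite h1 (le_trans h2).
- by apply: (le_trans _ (Ge i.+1 im)); rewrite cE lerDl ltW.
Qed.

Lemma feedback_error T : (forall k, kappa k 0 = 0) -> small_until T ->
  gain ^+ m * eps <= r / L / 2 ->
  forall (i : 'I_m) t, D i.+1 <= t <= T ->
    `|W t 0 i - kappa i (X t)| <= L * gain ^+ m * eps.
Proof.
move=> k0 sT Gr i t tT; have /andP[Dt tT'] := tT.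
have L0 : 0 < L by exact: lt_le_trans L1.
have rL : r / L <= r by rewrite ler_pdivrMr // ler_peMr // ltW.
have rL0 : 0 < r / L by rewrite divr_gt0.
have Ge : gain ^+ i.+1 * eps <= gain ^+ m * eps by rewrite ler_wpM2r ?gain_le // ltW.
have e1 := prediction_error k0 sT Gr (ltn_ord i) tT.
have [Xt _] : `|X t| <= r / L / 2 /\ `|W t| <= r / L / 2.
  by apply: sT; rewrite tT' andbT (le_trans _ Dt) // delay_ge0.
rewrite input_feedback //; apply: (le_trans (kL _ _ _)).
- rewrite -(subrK (X t) (q _ _)); apply: (le_trans (ler_normD _ _)); lra.
- by apply: (le_trans Xt); lra.
- by rewrite -mulrA ler_wpM2l ?(ltW L0) // ltW // (lt_le_trans e1).
Qed.

(** * Initial data and the vanishing of the feedbacks at 0 *)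

Hypotheses (X0 : `|X 0| <= delta)
  (W0 : forall (i : 'I_m) t, 0 <= t < D i.+1 -> `|W t 0 i| <= delta).

(** The right endpoint [D i.+1] corresponds to [U i 0], a value prescribed by the feedback and not
    by the initial history. Continuity of [U i] carries the bound over to it, which is what ties the
    feedback to the initial data. *)
Lemma initial_input (i : 'I_m) t : 0 <= t <= D i.+1 -> `|W t 0 i| <= delta.
Proof.
move=> /andP[t0]; rewrite le_eqVlt => /predU1P[->|ti]; last by rewrite W0 // t0.
have Di : 0 < D i.+1.
  by apply: (lt_le_trans D1); apply: delay_le; rewrite /= ltn_ord.
apply: (within_le_left _ Di) (W0 (i := i)).
have Wc : {within `[0, D i.+1], continuous W}.
  apply: continuous_subspaceW input_continuous => x /=.
  by rewrite !in_itv /= andbT => /andP[].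
move=> x; apply: cvg_norm.
apply: (@within_continuous_comp _ _ _ _ W (fun M : 'rV[R]_m => M 0 i)) => // M _.
exact: coord_continuous.
Qed.

(** All stages are evaluated at controller time 0 and compared with the zero solution, since nothing
    is known yet about X at positive times. The bound k on the stages allows for feedbacks that are
    known to vanish at 0 only for small indices. *)
Lemma initial_prediction k : (k <= m)%N -> (forall j : 'I_m, (j.+1 < k)%N -> kappa j 0 = 0) ->
  gain ^+ m * (delta + eps) <= r / L / 2 ->
  forall i, (i <= k)%N -> `|q i (D i)| < gain ^+ i * (delta + eps).
Proof.
move=> km k0 Gr.
have L0 : 0 < L by exact: lt_le_trans L1.
have rL : r / L <= r by rewrite ler_pdivrMr // ler_peMr // ltW.
have rL0 : 0 < r / L by rewrite divr_gt0.
have E1 := growth_ge1; have G1 := gain_ge1.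
set sg := delta + eps in Gr *; have sg0 : 0 < sg by rewrite ltr_wpDl.
have Gs i : (i <= m)%N -> gain ^+ i * sg <= r / L / 2.
  by move=> im; apply: le_trans Gr; rewrite ler_wpM2r ?gain_le // ltW.
elim => [_|i IH ik].
  rewrite /prediction D0 /= subr0 expr0 mul1r (le_lt_trans X0) //.
  by rewrite /sg ltrDl.
have im : (i < m)%N by exact: leq_trans km.
pose c := gain ^+ i * sg.
have dc : delta <= c.
  apply: (@le_trans _ _ sg); first by rewrite /sg lerDl ltW.
  by rewrite /c ler_peMl ?(ltW sg0) // exprn_ege1.
have ec : eps <= c.
  apply: (@le_trans _ _ sg); first by rewrite /sg lerDr.
  by rewrite /c ler_peMl ?(ltW sg0) // exprn_ege1.
have c0 : 0 < c by exact: lt_le_trans ec.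
have cE : growth L (D m) * c + eps <= gain ^+ i.+1 * sg.
  have -> : gain ^+ i.+1 * sg = growth L (D m) * L * c + c.
    by rewrite exprS /c {1}/gain; ring.
  by rewrite lerD // ler_wpM2r ?(ltW c0) // ler_peMr // (le_trans _ E1).
apply: (lt_le_trans _ cE); rewrite -[X in `|X|]subr0.
have hin s : 0 <= s <= 1 -> forall l, `|input_history i (D i.+1) s 0 l| <= delta.
  move=> s01 l; rewrite mxE; apply: initial_input.
  have /andP[h1 h2] := affine_in im (lexx _) s01.
  rewrite (le_trans (delay_ge0 (ltnW im)) h1) (le_trans h2) //.
  by apply: delay_le; rewrite ltnS tail_ord_ge ltn_ord.
apply: (@prediction_step i _ (cst 0) (cst 0) c im (lexx _)) => //.
- by move=> j ji; rewrite k0 // (leq_trans _ ik).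
- by apply: continuous_subspaceT => x; exact: cvg_cst.
- move=> s _; rewrite /cst.
  by rewrite f00 scaler0; exact: is_derive_cst.
- by move=> s _; rewrite normr0 ltW // divr_gt0.
- by move=> s _; rewrite normr0 ltW.
- move=> s s01 l; apply: (le_trans (hin s s01 l)); apply: (le_trans dc).
  by have := Gs i (ltnW im); rewrite -/c; lra.
- by move=> s _ j ji; rewrite k0 ?(leq_trans _ ik) // mxE subrr normr0 ltW.
- by move=> s s01 l; rewrite [X in _ - X]mxE subr0 (le_trans (hin s s01 l)).
- rewrite subr0 subKr; exact: IH (ltnW ik).
- by apply: le_trans (Gs i.+1 im); apply: le_trans cE; rewrite lerDl ltW.
Qed.

(* A feedback with kappa_i(0) <> 0 would force U_i(0) = kappa_i(P_i(0)) away from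
   0, hence Gamma(0) too. *)
Lemma feedback_zero :
  gain ^+ m * (delta + eps) <= r / L / 2 ->
  (forall k, kappa k 0 != 0 -> (L * gain ^+ m + 1) * (delta + eps) < `|kappa k 0|) ->
  forall k, kappa k 0 = 0.
Proof.
move=> Gr nz.
suff H i : forall k : 'I_m, (k : nat) = i -> kappa k 0 = 0 by move=> k; exact: (H k).
elim/ltn_ind: i => i IH k ki; apply/eqP/negPn/negP => /[dup] kn0 /nz; apply/negP; rewrite -leNgt.
have L0 : 0 < L by exact: lt_le_trans L1.
have rL : r / L <= r by rewrite ler_pdivrMr // ler_peMr // ltW.
have rL0 : 0 < r / L by rewrite divr_gt0.
set sg := delta + eps in Gr *; have sg0 : 0 < sg by rewrite ltr_wpDl.
(* The predictor behind feedback k involves only feedbacks of smaller index, and these vanish at 0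
   by strong induction. *)
have k0 (j : 'I_m) : (j.+1 < k.+1)%N -> kappa j 0 = 0.
  by rewrite ltnS ki => ji; exact: (IH j).
have := initial_prediction (ltn_ord k) k0 Gr (leqnn _); set Q := q _ _ => Qs.
have Gs : gain ^+ k.+1 * sg <= gain ^+ m * sg by rewrite ler_wpM2r ?gain_le // ltW.
have Dk : 0 <= D k.+1 <= D k.+1 by rewrite lexx delay_ge0.
(* At plant time [D k.+1] the input is both within [delta], as a limit of the initial history, and
   equal to [kappa k Q] with [Q] near 0. *)
have := initial_input Dk; rewrite input_feedback // -/Q => Kd.
have K1 : `|kappa k 0 - kappa k Q| <= L * (gain ^+ m * sg).
  apply: (le_trans (kL _ _ _)); first by rewrite normr0 ltW.
    by rewrite -/sg in Qs; lra.
  by rewrite ler_wpM2l ?(ltW L0) // sub0r normrN (le_trans (ltW Qs)).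
rewrite -(subrK (kappa k Q) (kappa k 0)) (le_trans (ler_normD _ _)) //.
by rewrite mulrDl mul1r -mulrA lerD // (le_trans Kd) // /sg lerDl ltW.
Qed.

(** * A priori bounds and the continuous induction *)

Definition input_gain : R := L * gain ^+ m.
(** Gronwall factor over [[0, D m]] for the derivative bound [L ^+ 2 * |X| + L * (1 + C) * (delta +
    eps)]. *)
Definition transient_gain : R :=
  (1 + L * (1 + input_gain) * D m) * expR (L ^+ 2 * D m).
Notation C := input_gain.
Notation A1 := transient_gain.
Notation sg := (delta + eps).

Lemma input_gain_ge0 : 0 <= C.
Proof.
by rewrite /input_gain mulr_ge0 ?exprn_ge0 ?(le_trans _ L1) ?(le_trans _ gain_ge1).
Qed.

Lemma transient_gain_ge1 : 1 <= A1.
Proof.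
have D0' := delay_ge0 (leqnn m); have C0 := input_gain_ge0.
have L0 : 0 <= L by exact: le_trans L1.
rewrite /transient_gain -[leLHS]mulr1 ler_pM //.
  by rewrite lerDl !mulr_ge0 // addr_ge0.
by rewrite -expR0 ler_expR mulr_ge0 // exprn_ge0.
Qed.

Section bootstrap.
Hypotheses (k0 : forall k, kappa k 0 = 0) (Gr : gain ^+ m * eps <= r / L / 2).

Lemma input_bound T : small_until T -> forall t, 0 <= t <= T ->
  `|W t| <= L * `|X t| + (1 + C) * sg.
Proof.
move=> sT t tT; have C0 := input_gain_ge0.
have L0 : 0 < L by exact: lt_le_trans L1.
have rL : r / L <= r by rewrite ler_pdivrMr // ler_peMr // ltW.
have rL0 : 0 < r / L by rewrite divr_gt0.
have h0 : 0 <= L * `|X t| by rewrite mulr_ge0 // ltW.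
have sg0 : 0 < sg by rewrite ltr_wpDl.
have h1 : 0 <= C * sg by rewrite mulr_ge0 // ltW.
have h2 : C * eps <= C * sg by rewrite ler_wpM2l // lerDr.
apply: mx_norm_le => [|i0 i]; first by rewrite mulrDl; lra.
rewrite ord1 mulrDl mul1r; have /andP[t0 tT'] := tT.
have [tD|Dt] := leP t (D i.+1).
  have := initial_input (i := i) (t := t); rewrite t0 tD => /(_ isT) /le_trans; apply.
  by rewrite ler_wpDl // ler_wpDr // lerDl ltW.
have := feedback_error k0 sT Gr (i := i) (t := t).
rewrite (ltW Dt) tT' -/C => /(_ isT) e1.
have [Xt _] := sT t tT.
have := @kL i (X t) 0; rewrite k0 !subr0 normr0 => /(_ _ (ltW r0)) e2.
rewrite -(subrK (kappa i (X t)) (W t 0 i)); apply: (le_trans (ler_normD _ _)).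
have {}e2 : `|kappa i (X t)| <= L * `|X t| by apply: e2; lra.
lra.
Qed.

(** From [D m] on every input is feedback, so in contrast to [input_bound] no [delta] is left;
    without this the inputs could not be shown to decay. *)
Lemma late_input_bound T : small_until T -> forall t, D m <= t <= T ->
  `|W t| <= L * `|X t| + C * eps.
Proof.
move=> sT t /andP[Dt tT]; have C0 := input_gain_ge0.
have L0 : 0 < L by exact: lt_le_trans L1.
have rL : r / L <= r by rewrite ler_pdivrMr // ler_peMr // ltW.
have rL0 : 0 < r / L by rewrite divr_gt0.
apply: mx_norm_le => [|i0 i]; first by rewrite addr_ge0 // mulr_ge0 // ltW.
have Di : D i.+1 <= t.
  by apply: le_trans Dt; apply: delay_le; rewrite ltn_ord leqnn.
rewrite ord1; have := feedback_error k0 sT Gr (i := i) (t := t).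
rewrite Di tT -/C => /(_ isT) e1.
have [|Xt _] := sT t; first by rewrite tT (le_trans _ Dt) // delay_ge0.
have := @kL i (X t) 0; rewrite k0 !subr0 normr0 => /(_ _ (ltW r0)) e2.
rewrite -(subrK (kappa i (X t)) (W t 0 i)); apply: (le_trans (ler_normD _ _)).
have {}e2 : `|kappa i (X t)| <= L * `|X t| by apply: e2; lra.
lra.
Qed.

Lemma transient_bound T : small_until T -> forall t, 0 <= t <= T -> t <= D m ->
  `|X t| < A1 * sg.
Proof.
move=> sT t /andP[t0 tT] tD; have C0 := input_gain_ge0.
have L0 : 0 < L by exact: lt_le_trans L1.
have rL : r / L <= r by rewrite ler_pdivrMr // ler_peMr // ltW.
have rL0 : 0 < r / L by rewrite divr_gt0.
have sg0 : 0 < sg by rewrite ltr_wpDl.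
pose c := L * ((1 + C) * sg).
have c1 : 0 <= (1 + C) * sg by rewrite mulr_ge0 ?addr_ge0 // ltW.
have c0 : 0 <= c by rewrite mulr_ge0 // ltW.
apply: (@lt_le_trans _ _ ((sg + c * t) * expR (L ^+ 2 * t))); last first.
  have -> : A1 * sg = (sg + c * D m) * expR (L ^+ 2 * D m).
    by rewrite /transient_gain /c; ring.
  apply: ler_pM; [|exact: expR_ge0| |].
  - by apply: addr_ge0; [exact: ltW | exact: mulr_ge0].
  - by rewrite lerD2l ler_wpM2l.
  - by rewrite ler_expR ler_wpM2l // sqr_ge0.
apply: (@gronwall R 1 n t (L ^+ 2) sg c _ X (fun s => f (X s) (W s))) => //.
- exact: sqr_ge0.
- apply: continuous_subspaceW state_continuous => x /=.
  by rewrite !in_itv /= andbT => /andP[].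
- by move=> s /andP[s0 _]; exact: state_derive.
- move=> s /andP[s0 st] _.
  have sT' : 0 <= s <= T by rewrite (ltW s0) ltW // (lt_le_trans st).
  have [Xs Ws] := sT s sT'.
  have -> : f (X s) (W s) = f (X s) (W s) - f 0 0 by rewrite f00 subr0.
  have -> : L ^+ 2 * `|X s| + c = L * (L * `|X s| + (1 + C) * sg) by rewrite /c; ring.
  apply: fL; rewrite ?normr0 ?subr0 ?(ltW r0) //.
  + by apply: (le_trans Xs); lra.
  + by apply: (le_trans Ws); lra.
  + by rewrite ler_wpDr ?ler_peMl // mulr_ge0 ?addr_ge0 // ltW.
  + exact: (input_bound sT).
- by rewrite (le_lt_trans X0) // ltrDl.
- by rewrite lexx t0.
Qed.

Variables (bI : R -> R -> R) (gI : R -> R).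
Hypotheses (bIK : class_KL bI) (gIK : class_K gI)
  (iss : forall T w Y, 0 <= T -> admissible_input T w ->
    caratheodory_solution (fun x w => f x (w + \row_i kappa i x)) T w Y ->
    forall t, t \in `[0, T] ->
      enorm (Y t) <= bI (enorm (Y 0)) t + gI (sup [set enorm (w s) | s in `[0, t]])).

Lemma asymptotic_bound T : small_until T -> forall t, D m <= t <= T ->
  enorm (X t) <= bI (n%:R * (A1 * sg)) (t - D m) + gI (m%:R * (C * eps)).
Proof.
move=> sT t /andP[Dt tT]; have C0 := input_gain_ge0.
have Dm0 := delay_ge0 (leqnn m).
(* The clock is restarted at [D m], and the disturbance is the deviation of the actual input from
   the ideal feedback, bounded by [feedback_error]. The factor 1 fits the affine changes of time
   treated above. *)
pose Y s := X (D m + 1 * s).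
pose w s := W (D m + 1 * s) - \row_i kappa i (Y s).
have inT s : 0 <= s <= t - D m -> 0 <= D m + 1 * s <= T.
  by move=> /andP[s0 st]; apply/andP; split; lra.
have shc (Z : topologicalType) (h : R -> Z) : {within `[0, +oo[, continuous h} ->
    {within `[0, t - D m], continuous (fun s => h (D m + 1 * s))}.
  move=> hc; apply: (within_comp _ _ hc) => [|s /=].
    by apply: continuous_subspaceT; exact: affine_continuous.
  by rewrite !in_itv /= andbT => /inT /andP[].
have Yc := shc _ _ state_continuous; have Wc := shc _ _ input_continuous.
have wc : {within `[0, t - D m], continuous w}.
  move=> s; apply: cvgB; first exact: Wc.
  apply: cvg_mx_coord => i j; rewrite mxE.
  rewrite (_ : (fun y => _) = (fun y => kappa j (Y y))); last first.
    by apply/funext => y; rewrite mxE.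
  by apply: (@cvg_comp _ _ _ Y (kappa j) _ (nbhs (Y s))); [exact: Yc | exact: kc].
have wb s : 0 <= s <= t - D m -> enorm (w s) <= m%:R * (C * eps).
  move=> s0t; apply: (le_trans (enorm_le_norm _)); rewrite ler_wpM2l //.
  apply: mx_norm_le => [|i0 i]; first by rewrite mulr_ge0 // ltW.
  rewrite ord1 mxE [X in _ + X]mxE [X in _ - X]mxE /Y; apply: (feedback_error k0 sT Gr).
  have /andP[_ ->] := inT s s0t; rewrite andbT.
  have /andP[s0 _] := s0t.
  have : D i.+1 <= D m by apply: delay_le; rewrite ltn_ord leqnn.
  lra.
have t0 : 0 <= t - D m by rewrite subr_ge0.
have adm : admissible_input (t - D m) w.
  split=> [j|].
    apply: subspace_continuous_measurable_fun => //.
    apply: (@within_continuous_comp _ _ _ _ w (fun M : 'rV[R]_m => M 0 j)) => // M _.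
    exact: coord_continuous.
  by exists (m%:R * (C * eps)) => s; rewrite in_itv /=; exact: wb.
have car : caratheodory_solution (fun x w => f x (w + \row_i kappa i x)) (t - D m) w Y.
  split=> // s; rewrite in_itv /=.
  rewrite (_ : (fun _ => _) = (fun s => f (Y s) (W (D m + 1 * s)))); last first.
    by apply/funext => u; rewrite /w subrK.
  apply: vintegral_is_derive; [exact: Yc | exact: within_continuous_field | ].
  move=> u /andP[u0 _]; rewrite -[f _ _]scale1r; apply: is_derive_affine.
  by apply: state_derive; rewrite mul1r ltr_wpDl.
have tt : t - D m \in `[0, t - D m] by rewrite in_itv /= t0 lexx.
have := iss t0 adm car tt.
have -> : Y (t - D m) = X t by rewrite /Y mul1r subrKC.
move=> /le_trans; apply; apply: lerD.
  have [_ bK _ _] := bIK; apply: (class_K_le (bK _ t0)); first exact: enorm_ge0.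
  rewrite /Y mulr0 addr0 (le_trans (enorm_le_norm _)) // ler_wpM2l // ltW //.
  by apply: (transient_bound sT) => //; rewrite Dm0 (le_trans Dt).
have ub : ubound [set enorm (w s) | s in `[0, t - D m]] (m%:R * (C * eps)).
  by move=> _ [s /= + <-]; rewrite in_itv /=; exact: wb.
have w0in : [set enorm (w s) | s in `[0, t - D m]] (enorm (w 0)).
  by exists 0 => //=; rewrite in_itv /= lexx.
apply: class_K_le => //; last by apply: ge_sup => //; exists (enorm (w 0)).
apply: (le_trans (enorm_ge0 (w 0))).
have hub : has_ubound [set enorm (w s) | s in `[0, t - D m]] by eexists; exact: ub.
exact: (ub_le_sup hub).
Qed.

(** The first hypothesis serves the times up to [D m], the second the later ones. Both bound the
    input, and since [1 <= L] also the state; being strict, they give the strict improvement that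
    the induction needs. *)
Lemma stays_small :
  L * (A1 * sg) + (1 + C) * sg < r / L / 2 ->
  L * (bI (n%:R * (A1 * sg)) 0 + gI (m%:R * (C * eps))) + C * eps < r / L / 2 ->
  forall T, small_until T.
Proof.
move=> h1 h2.
have L0 : 0 < L by exact: lt_le_trans L1.
have rL0 : 0 < r / L by rewrite divr_gt0.
have C0 := input_gain_ge0; have A10 := transient_gain_ge1.
have sg0 : 0 < sg by rewrite ltr_wpDl.
have A1s : 0 <= A1 * sg by rewrite mulr_ge0 ?(ltW sg0) // (le_trans _ A10).
have Cs : 0 <= C * eps by rewrite mulr_ge0 // ltW.
have Dm0 := delay_ge0 (leqnn m).
have dr : delta <= r / L / 2.
  apply: ltW; apply: le_lt_trans h1; have : 0 <= C * sg by rewrite mulr_ge0 // ltW.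
  have : 0 <= L * (A1 * sg) by rewrite mulr_ge0 // ltW.
  by rewrite mulrDl mul1r; have := eps0; lra.
pose g t := Num.max `|X t| `|W t| - r / L / 2.
suff H t : 0 <= t -> g t < 0.
  move=> T t /andP[t0 _]; have := H t t0; rewrite subr_lt0 gt_max => /andP[a b].
  by rewrite !ltW.
move: t; apply: continuous_induction => [||s s0 sm].
- move=> t; apply: cvgB; last exact: cvg_cst.
  apply: (@cvg_comp2 (subspace `[0, +oo[) _ _ _ _ (nbhs `|X t|) (nbhs `|W t|) _ _ _ _
    (fun t => `|X t|) (fun t => `|W t|) Num.max).
  + by apply: cvg_norm; exact: state_continuous.
  + by apply: cvg_norm; exact: input_continuous.
  + exact: (@max_continuous _ _ (`|X t|, `|W t|)).
- rewrite subr_le0 ge_max; apply/andP; split.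
    exact: (le_trans X0).
  apply: mx_norm_le => [|i0 i]; first by rewrite divr_ge0 // ltW.
  rewrite ord1; apply: le_trans dr; apply: initial_input.
  by rewrite lexx delay_ge0.
- have sT : small_until s.
    by move=> u us; have := sm u us; rewrite subr_le0 ge_max => /andP[].
  rewrite subr_lt0 gt_max.
  have ss : 0 <= s <= s by rewrite s0 lexx.
  have Wb := input_bound sT ss.
  have [sD|Ds] := leP s (D m).
    have := transient_bound sT ss sD => Xb.
    have LX : L * `|X s| <= L * (A1 * sg) by rewrite ler_wpM2l // ltW.
    have A1L : A1 * sg <= L * (A1 * sg) by rewrite ler_peMl.
    have C1 : 0 <= (1 + C) * sg by rewrite mulr_ge0 ?addr_ge0 // ltW.
    by apply/andP; split; lra.
  have Dss : D m <= s <= s by rewrite (ltW Ds) lexx.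
  have := asymptotic_bound sT Dss; set b := bI _ _; set gv := gI _ => Xb.
  have bb : b <= bI (n%:R * (A1 * sg)) 0.
    by have [_ _ bd _] := bIK; apply: bd => //; [exact: mulr_ge0 | rewrite subr_ge0 ltW].
  have Xs : `|X s| <= bI (n%:R * (A1 * sg)) 0 + gv.
    by apply: (le_trans (norm_le_enorm _)); apply: (le_trans Xb); rewrite lerD2r.
  move: h2 Xs; rewrite -/gv; set bv := bI _ 0 + gv => h2 Xs.
  have b0 : 0 <= bv by exact: le_trans Xs.
  have LX : L * `|X s| <= L * bv by rewrite ler_wpM2l // ltW.
  have bL : bv <= L * bv by rewrite ler_peMl.
  have := late_input_bound sT Dss => Wl.
  by apply/andP; split; lra.
Qed.

(** A sum is at most twice its larger term. The part due to [eps] is frozen at time 0, since it has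
    to end up in the constant offset alpha1. *)
Lemma KL_split s : 0 <= s ->
  bI (n%:R * (A1 * sg)) s <=
    bI (2 * (n%:R * A1) * delta) s + bI (2 * (n%:R * A1) * eps) 0.
Proof.
move=> s0; have [_ bK bd _] := bIK.
have nA : 0 <= n%:R * A1 by rewrite mulr_ge0 // (le_trans _ transient_gain_ge1).
have pos x : 0 <= x -> 0 <= 2 * (n%:R * A1) * x by move=> x0; do 2!rewrite mulr_ge0 //.
have bge x t : 0 <= x -> 0 <= t -> 0 <= bI x t.
  by move=> x0 t0; exact: (class_K_ge0 (bK t t0)).
have eps0' := ltW eps0.
have [de|ed] := leP delta eps.
  apply: (@le_trans _ _ (bI (2 * (n%:R * A1) * eps) s)).
    apply: (class_K_le (bK s s0)).
      by rewrite mulrA mulr_ge0 // addr_ge0.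
    rewrite mulrA [leRHS]mulrAC mulrC; apply: ler_wpM2r => //; lra.
  by rewrite ler_wpDl ?bge ?pos // bd // pos.
apply: (@le_trans _ _ (bI (2 * (n%:R * A1) * delta) s)).
  apply: (class_K_le (bK s s0)).
    by rewrite mulrA mulr_ge0 // addr_ge0.
  rewrite mulrA [leRHS]mulrAC mulrC; apply: ler_wpM2r => //; lra.
by rewrite lerDl bge // pos.
Qed.

(** A common bound for all coefficients in the estimates of the state and of the m inputs, so
    generous that what remains in [Gamma_bound] is a sum of nonnegative terms. *)
Definition overall_gain : R :=
  1 + m%:R * L + n%:R * A1 + m%:R * C + m%:R * (L * A1 + (1 + C)).

Lemma Gamma_bound : (forall T, small_until T) -> forall t, 0 <= t ->
  Gamma D X U t <=
    overall_gain * (bI (2 * (n%:R * A1) * delta) (Num.max 0 (t - D m))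
                    + delta * expR (D m - t))
    + overall_gain * (bI (2 * (n%:R * A1) * eps) 0 + gI (m%:R * (C * eps)) + eps).
Proof.
move=> sm t t0; have C0 := input_gain_ge0; have A11 := transient_gain_ge1.
have L0 : 0 < L by exact: lt_le_trans L1.
have A10 : 0 <= A1 by exact: le_trans A11.
have sg0 : 0 < sg by rewrite ltr_wpDl.
have eps0' := ltW eps0.
have nA : 0 <= n%:R * A1 by rewrite mulr_ge0.
have pos x : 0 <= x -> 0 <= 2 * (n%:R * A1) * x by move=> x0; do 2!rewrite mulr_ge0 //.
have [_ bK bd _] := bIK.
have bge x s : 0 <= x -> 0 <= s -> 0 <= bI x s.
  by move=> x0 s0; exact: (class_K_ge0 (bK s s0)).
have s0 : 0 <= Num.max 0 (t - D m) by rewrite le_max lexx.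
have mCe : 0 <= m%:R * (C * eps) by do 2!rewrite mulr_ge0 //.
have gge : 0 <= gI (m%:R * (C * eps)) by exact: class_K_ge0.
set b := bI (2 * _ * delta) _; set be := bI (2 * _ * eps) _; set g := gI _ in gge *.
set d := delta * expR _; set A2 := L * A1 + (1 + C).
have b0 : 0 <= b by apply: bge => //; exact: pos.
have be0 : 0 <= be by apply: bge => //; exact: pos.
have d0 : 0 <= d by apply: mulr_ge0 => //; exact: expR_ge0.
have A20 : 0 <= A2.
  by apply: addr_ge0; [apply: mulr_ge0 => //; exact: ltW | exact: addr_ge0].
(* The sup norm of [u_i] at time t looks forward: it ranges over plant inputs at times [tau >= t].
   Decay at t therefore covers it without any further loss of time. *)
have late tau : t <= tau -> D m <= tau -> enorm (X tau) <= b + be + g.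
  move=> ttau Dtau.
  have Dtt : D m <= tau <= tau by rewrite Dtau lexx.
  apply: (le_trans (asymptotic_bound (sm tau) Dtt)); rewrite lerD2r.
  have Dt0 : 0 <= tau - D m by rewrite subr_ge0.
  apply: (le_trans (KL_split Dt0)); rewrite lerD2r.
  by apply: bd => //; [exact: pos | rewrite ge_max Dt0 lerD2r].
(* Up to [D m] the exponential factor is at least 1, so bounds proportional to [delta] are absorbed
   by [d]. *)
have early tau : t <= tau -> tau <= D m -> delta <= d.
  move=> ttau tauD; rewrite ler_peMr // -expR0 ler_expR subr_ge0.
  exact: le_trans tauD.
have HX : enorm (X t) <= b + n%:R * A1 * d + be + g + n%:R * A1 * eps.
  have [tD|Dt] := leP t (D m); last first.
    apply: (le_trans (late t (lexx _) (ltW Dt))).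
    have : 0 <= n%:R * A1 * d by exact: mulr_ge0.
    have : 0 <= n%:R * A1 * eps by exact: mulr_ge0.
    lra.
  have tt : 0 <= t <= t by rewrite t0 lexx.
  apply: (@le_trans _ _ (n%:R * (A1 * sg))).
    apply: (le_trans (enorm_le_norm _)); rewrite ler_wpM2l // ltW //.
    exact: (transient_bound (sm t) tt tD).
  have h : n%:R * A1 * delta <= n%:R * A1 * d.
    by rewrite ler_wpM2l // (early t).
  have -> : n%:R * (A1 * sg) = n%:R * A1 * delta + n%:R * A1 * eps by ring.
  lra.
have HW (i : 'I_m) tau : t <= tau ->
    `|W tau 0 i| <= L * (b + be + g) + A2 * d + (C + A2) * eps.
  move=> ttau; apply: (le_trans (mx_coord_le _ _ _)).
  have tau0 : 0 <= tau by exact: le_trans ttau.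
  have tt : 0 <= tau <= tau by rewrite tau0 lexx.
  have p1 : 0 <= A2 * d by exact: mulr_ge0.
  have p2 : 0 <= A2 * eps by exact: mulr_ge0.
  have p3 : 0 <= C * eps by exact: mulr_ge0.
  have p4 : 0 <= L * (b + be + g) by rewrite mulr_ge0 ?(ltW L0) // !addr_ge0.
  rewrite [(C + A2) * eps]mulrDl.
  have [tD|Dt] := leP tau (D m); last first.
    have Dtt : D m <= tau <= tau by rewrite (ltW Dt) lexx.
    apply: (le_trans (late_input_bound (sm tau) Dtt)).
    have : L * `|X tau| <= L * (b + be + g).
      by rewrite ler_wpM2l ?(ltW L0) // (le_trans (norm_le_enorm _)) // late // ltW.
    lra.
  apply: (le_trans (input_bound (sm tau) tt)).
  have : L * `|X tau| <= L * (A1 * sg).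
    by rewrite ler_wpM2l ?(ltW L0) // ltW // (transient_bound (sm tau) tt tD).
  have : A2 * delta <= A2 * d by rewrite ler_wpM2l // (early tau).
  have : L * (A1 * sg) + (1 + C) * sg = A2 * delta + A2 * eps by rewrite /A2; ring.
  lra.
have HS (i : 'I_m) : sup [set `|U i (t + x - D i.+1)| | x in `[0, D i.+1[] <=
    L * (b + be + g) + A2 * d + (C + A2) * eps.
  apply: ge_sup.
    exists `|U i (t + 0 - D i.+1)|; exists 0 => //=.
    rewrite in_itv /= lexx /= (lt_le_trans D1) //.
    by apply: delay_le; rewrite /= ltn_ord.
  move=> _ [x /= + <-]; rewrite in_itv /= => /andP[x0 _].
  have := HW i (t + x); rewrite mxE; apply; by rewrite lerDl.
have HSm : \sum_(i < m) sup [set `|U i (t + x - D i.+1)| | x in `[0, D i.+1[] <=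
    m%:R * (L * (b + be + g) + A2 * d + (C + A2) * eps).
  rewrite mulr_natl -[m in leRHS]card_ord -sumr_const.
  by apply: ler_sum => i _; exact: HS.
apply: (le_trans (lerD HX HSm)); rewrite -subr_ge0 /overall_gain -/A2.
have -> : (1 + m%:R * L + n%:R * A1 + m%:R * C + m%:R * A2) * (b + d) +
    (1 + m%:R * L + n%:R * A1 + m%:R * C + m%:R * A2) * (be + g + eps) -
    (b + n%:R * A1 * d + be + g + n%:R * A1 * eps +
     m%:R * (L * (b + be + g) + A2 * d + (C + A2) * eps)) =
    (n%:R * A1 + m%:R * C + m%:R * A2) * (b + be + g) +
    (1 + m%:R * L + m%:R * C) * d + (1 + m%:R * L) * eps by ring.
have mL : 0 <= m%:R * L by rewrite mulr_ge0 // ltW.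
have mC : 0 <= m%:R * C by rewrite mulr_ge0.
have mA : 0 <= m%:R * A2 by rewrite mulr_ge0.
by rewrite !addr_ge0 // mulr_ge0 // !addr_ge0.
Qed.
End bootstrap.

End closed_loop.

(** * Choice of the comparison functions and conclusion *)

Lemma history_le_Gamma (R : realType) (n m : nat) (D : nat -> R) (X : R -> 'rV[R]_n)
    (U : 'I_m -> R -> R) :
  (forall i : 'I_m, 0 < D i.+1) ->
  (forall i : 'I_m, {within `[- D i.+1, +oo[, continuous (U i)}) ->
  `|X 0| <= Gamma D X U 0 /\
  forall (i : 'I_m) t, 0 <= t < D i.+1 -> `|U i (t - D i.+1)| <= Gamma D X U 0.
Proof.
move=> D0 Uc.
(* Needed for the [sup] in [Gamma] to dominate its elements; it comes from continuity on the closed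
   interval, whose right end corresponds to [U i 0]. *)
have hub (i : 'I_m) : has_ubound [set `|U i (0 + x - D i.+1)| | x in `[0, D i.+1[].
  have c : {within `[0, D i.+1], continuous (fun x => `|U i (0 + x - D i.+1)|)}.
    move=> x; apply: cvg_norm; move: x; apply: (within_comp _ _ (Uc i)) => [|x /=].
      apply: continuous_subspaceT => x; apply: cvgB; last exact: cvg_cst.
      by apply: cvgD; [exact: cvg_cst | exact: cvg_id].
    by rewrite !in_itv /= andbT add0r => /andP[x0 _]; rewrite lerBrDr addNr.
  have [z _ zmax] := EVT_max (ltW (D0 i)) c.
  exists `|U i (0 + z - D i.+1)| => _ [x /= xD <-]; apply: zmax.
  by move: xD; rewrite !in_itv /= => /andP[-> /ltW].
have h (i : 'I_m) t : 0 <= t < D i.+1 ->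
    `|U i (t - D i.+1)| <= sup [set `|U i (0 + x - D i.+1)| | x in `[0, D i.+1[].
  by move=> tD; apply: (ub_le_sup (hub i)); exists t; rewrite /= ?in_itv // add0r.
have s0 (i : 'I_m) : 0 <= sup [set `|U i (0 + x - D i.+1)| | x in `[0, D i.+1[].
  by apply: le_trans (h i 0 _); rewrite ?lexx ?D0.
split=> [|i t tD].
  by rewrite /Gamma (le_trans (norm_le_enorm _)) // lerDl sumr_ge0.
apply: (le_trans (h i t tD)); rewrite /Gamma (bigD1 i) //= addrCA lerDl.
by rewrite addr_ge0 ?enorm_ge0 ?sumr_ge0.
Qed.

Theorem theorem10 (R : realType) (n m : nat)
    (f : 'rV[R]_n -> 'rV[R]_m -> 'rV[R]_n) (D : nat -> R)
    (XX : set 'rV[R]_n) (UU : set R) (Xbar Ubar : R)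
    (kappa : 'I_m -> 'rV[R]_n -> R) (Cf : R) (P : operators R n m)
    (n_gt0 : (0 < n)%N) (m_gt0 : (0 < m)%N)
    (D0 : D 0%N = 0) (D1 : 0 < D 1%N)
    (D_le : forall i, (0 < i < m)%N -> D i <= D i.+1)
    (f_lip : locally_lipschitz f) (f0 : f 0 0 = 0)
    (XX_compact : compact XX) (UU_compact : compact UU)
    (Xbar_ge0 : 0 <= Xbar) (Ubar_ge0 : 0 <= Ubar)
    (XX_le : forall x, XX x -> enorm x <= Xbar)
    (UU_le : forall u, UU u -> `|u| <= Ubar)
    (kappa_C1 : forall i, Ck 1 (kappa i))
    (H1 : GAS (fun x => f x (\row_i kappa i x)))
    (Cf_gt0 : 0 < Cf)
    (H2 : forall (x1 x2 : 'rV[R]_n) (u v : 'rV[R]_m), XX x1 -> XX x2 ->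
      (forall i, UU (u 0 i)) -> (forall i, UU (v 0 i)) ->
      enorm (f x1 u - f x2 v)
        <= Cf * (enorm (x1 - x2) + \sum_i `|u 0 i - v 0 i|))
    (H3 : strongly_forward_complete f)
    (H4 : ISS (fun x (w : 'rV[R]_m) => f x (w + \row_i kappa i x)))
    (H5 : forall j, (0 < j <= m)%N ->
      strongly_forward_complete
        (fun x (w : 'rV[R]_(m - j)) => f x (mixed_input kappa x w)))
    (P_predictor : predictor_operators f kappa P) :
  let B := Num.min Xbar Ubar in
  exists (alpha1 : R -> R) (beta : R -> R -> R),
  [/\ class_K alpha1, class_KL beta, in_K_range alpha1 B &
    forall eps, 0 < eps -> eps < eps_star m alpha1 B ->
      let Om := Omega m alpha1 beta eps B in
      in_K_range (beta^~ 0) (B - alpha1 (m%:R * eps)) /\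
      forall (Phat : operators R n m) (Phi : set R),
        maps_C1 Phat ->
        (forall i, (i < m)%N -> neural_operator (Phat i)) ->
        (forall phi, Phi phi -> 0 <= phi) -> bounded_set Phi ->
        (forall i, (i < m)%N -> Phi (D i.+1 - D i)) ->
        uniform_error P Phat XX UU Phi eps ->
        semiglobally_trained XX UU B (beta Om 0) ->
        forall (X : R -> 'rV[R]_n) (U : 'I_m -> R -> R),
          closed_loop_solution f kappa D Phat X U ->
          Gamma D X U 0 <= Om ->
          forall t, 0 <= t ->
            Gamma D X U t <= beta (Gamma D X U 0) t + alpha1 (m%:R * eps)].
Proof.
move=> B.
have kc k : continuous (kappa k) by case: (kappa_C1 k).
(* For B = 0 the bound on eps is contradictory, but the functions must exist. *)
pose b := if 0 < B then B / n.+1%:R else 1.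
have b0 : 0 < b by rewrite /b; case: ifP => // B0; rewrite divr_gt0.
have [L [r [L1 r0 rb fL kL]]] := local_lipschitz_constants b0 f_lip kappa_C1.
have [bI [gI [bIK gIK iss]]] := H4.
have [_ bK bd _] := bIK; have bK0 := bK 0 (lexx _).
pose g := gain m D L ^+ m; pose C := input_gain m D L; pose A1 := transient_gain m D L.
pose Kx := n%:R * A1; pose A0 := overall_gain n m D L.
have L0 : 0 < L by exact: lt_le_trans L1.
have g1 : 1 <= g by rewrite exprn_ege1 // gain_ge1.
have C0 : 0 < C by rewrite mulr_gt0 // (lt_le_trans _ g1).
have A11 : 1 <= A1 by exact: transient_gain_ge1.
have A10 : 0 < A1 by exact: lt_le_trans A11.
have K0 : 0 < Kx by rewrite mulr_gt0 // ltr0n.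
have LA0 : 0 < L * A1 by rewrite mulr_gt0.
have m0 : 0 < m%:R :> R by rewrite ltr0n.
have mC0 : 0 < m%:R * C by rewrite mulr_gt0.
have A01 : 1 <= A0.
  rewrite /A0 /overall_gain -/A1 -/C -/Kx -!addrA lerDl !addr_ge0 // ?(ltW K0) //;
    by rewrite mulr_ge0 // ?addr_ge0 // ltW.
pose rho := r / L / 2.
have rho0 : 0 < rho by rewrite !divr_gt0.
(* Both [bI] and [gI] will be below [e]; [L * (e + e) = rho / 2] then leaves [rho / 2] for
   [C * eps]. *)
pose e := rho / (4 * L).
have e0 : 0 < e by rewrite divr_gt0 // mulr_gt0.
have [d1 d10 hd1] := class_K_small bK0 e0.
have [d2 d20 hd2] := class_K_small gIK e0.
(* A single threshold for all smallness conditions, the last one separating nonzero values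
   [kappa k 0] from 0. *)
have [mu [mu_gt0 mud1 mud2 murho muk]] : exists mu, [/\ 0 < mu, mu <= d1, mu <= d2,
    mu <= rho / 2 & forall k, kappa k 0 != 0 -> mu <= `|kappa k 0|].
  pose mu0 := Num.min (Num.min d1 d2) (rho / 2).
  have mu00 : 0 < mu0 by rewrite !lt_min d10 d20 divr_gt0.
  pose mu := \big[Num.min/mu0]_(k | kappa k 0 != 0) `|kappa k 0|.
  have mu_le : mu <= mu0 by exact: bigmin_le_id.
  exists mu; split.
  - by apply: lt_bigmin => // k; rewrite normr_gt0.
  - by rewrite (le_trans mu_le) // /mu0 !ge_min lexx.
  - by rewrite (le_trans mu_le) // /mu0 !ge_min lexx orbT.
  - by rewrite (le_trans mu_le) // /mu0 !ge_min lexx orbT.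
  - by move=> k nz; exact: bigmin_le_cond.
have mu_rho : mu <= rho by rewrite (le_trans murho) // ler_pdivrMr // ler_peMr ?ler1n // ltW.
(* [Q] dominates every coefficient that multiplies [delta + eps] or [eps] below, so that one bound
   [eta] on these quantities is enough. *)
have [Q [Q0 gQ CQ LQ [KQ mQ]]] : exists Q, [/\ 0 < Q, g <= Q, C + 1 <= Q,
    L * A1 + (1 + C) <= Q & Kx <= Q /\ m%:R * C <= Q].
  pose Q := Num.max g (Num.max (C + 1) (Num.max (L * A1 + (1 + C))
    (Num.max Kx (m%:R * C)))).
  by exists Q; rewrite !lt_max !le_max !lexx (lt_le_trans ltr01 g1) !orbT.
have [eta eta0 small] : exists2 eta, 0 < eta &
    forall c s, 0 <= c -> c <= Q -> 0 <= s -> s <= eta -> c * s < mu.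
  exists (mu / (2 * Q)); first by rewrite divr_gt0 // mulr_gt0.
  move=> c s c0 cQ s0 se; apply: (@le_lt_trans _ _ (mu / 2)).
    have -> : mu / 2 = Q * (mu / (2 * Q)) by field; rewrite gt_eqF.
    exact: ler_pM.
  by rewrite ltr_pdivrMr // ltr_pMr // ltr1n.
have B_ge0 : 0 <= B by rewrite /B le_min Xbar_ge0.
(* beta(Gamma(0), 0) + alpha1(m eps) <= B will force Gamma(0) + eps <= B / A,
   which is at most eta. *)
pose A := A0 + B / eta.
have A0A : A0 <= A by rewrite /A lerDl divr_ge0 // ltW.
have A_gt0 : 0 < A by rewrite (lt_le_trans _ A0A) // (lt_le_trans _ A01).
have Dm0 : 0 <= D m by exact: (delay_ge0 D0 D1 D_le (leqnn m)).
(* The two halves of [Gamma_bound] with [A] for [overall_gain]. As alpha1 is taken at [m * eps], the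
   factor m in the argument of [gI] is already supplied; the other terms use [eps <= m * eps]. The
   linear terms make both slopes at least [A]. *)
pose alpha1 x := A * (bI (2 * Kx * x) 0 + gI (C * x) + x).
pose beta x t := A * (bI (2 * Kx * x) (Num.max 0 (t - D m)) + x * expR (D m - t)).
have KK0 : 0 < 2 * Kx by rewrite mulr_gt0.
have aK : class_K alpha1.
  apply: class_K_mull => //; apply: class_KD; first apply: class_KD.
  - exact: (class_K_scale bK0).
  - exact: (class_K_scale gIK).
  - have := class_K_linear (@ltr01 R); congr class_K.
    by apply/funext => x; rewrite mul1r.
have bKL : class_KL beta by exact: class_KL_delay.
have bge x t : 0 <= x -> 0 <= t -> 0 <= bI (2 * Kx * x) t.
  by move=> x0 t0; apply: (class_K_ge0 (bK t t0)); rewrite mulr_ge0 // ltW.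
have gge x : 0 <= x -> 0 <= gI (C * x).
  by move=> x0; apply: (class_K_ge0 gIK); rewrite mulr_ge0 // ltW.
have max0 t : 0 <= Num.max 0 (t - D m) by rewrite le_max lexx.
have aA x : 0 <= x -> A * x <= alpha1 x.
  by move=> x0; rewrite ler_pM2l // lerDr addr_ge0 ?bge ?gge.
have bA x : 0 <= x -> A * x <= beta x 0.
  move=> x0; rewrite ler_pM2l // ler_wpDl ?bge // ler_peMr //.
  by rewrite -expR0 ler_expR subr0.
have b0K : class_K (beta^~ 0) by case: bKL => _ + _ _; apply.
have aB : in_K_range alpha1 B by exact: (class_K_range aK A_gt0 aA).
exists alpha1, beta; split => // eps eps0 epslt Om.
have [K0' KB] := K_invP aB.
have me0 : 0 <= m%:R * eps by rewrite mulr_ge0 // ltW.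
(* This is what [eps < eps_star] means; it makes the argument of the inverse in [Omega] positive and
   forces [0 < B]. *)
have aeB : alpha1 (m%:R * eps) < B.
  rewrite -KB; have [_ ai _] := aK; apply: ai => //.
  by rewrite mulrC -ltr_pdivlMr.
have Bpos : 0 < B by apply: le_lt_trans aeB; exact: class_K_ge0.
have rng : in_K_range (beta^~ 0) (B - alpha1 (m%:R * eps)).
  by apply: (class_K_range b0K A_gt0 bA); rewrite subr_ge0 ltW.
split => // Phat Phi PhC _ Phi0 _ PhiD err [XXB UUB _] X U cl GOm t t0.
have [Om0 OmB] := K_invP rng; rewrite -/Om in Om0 OmB.
have bE : b = B / n.+1%:R by rewrite /b Bpos.
(* Passing from the sup norm to the Euclidean one costs a factor n, whence the division by [n.+1] in
   [b], which also gives [r <= B]. *)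
have nr : n%:R * r <= B.
  apply: (@le_trans _ _ (n%:R * b)); first by rewrite ler_wpM2l.
  by rewrite bE mulrCA ler_piMr // ler_pdivrMr // mul1r ler_nat.
have rB : r <= B.
  by apply: (le_trans rb); rewrite bE ler_pdivrMr // ler_peMr // ler1n.
have rXX x : `|x| <= r -> XX x.
  move=> xr; apply: XXB; apply: (le_trans (enorm_le_norm _)).
  by apply: le_trans nr; rewrite ler_wpM2l.
have rUU u : `|u| <= r -> UU u by move=> ur; apply: UUB; exact: le_trans rB.
have Dpos (i : 'I_m) : 0 < D i.+1.
  by apply: (lt_le_trans D1); apply: (delay_le D0 D1 D_le); rewrite /= ltn_ord.
have [_ UC _] := cl.
have [X0G W0G] := history_le_Gamma X Dpos (fun i => proj1 (UC i)).
set delta := Gamma D X U 0 in GOm X0G W0G *.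
have delta0 : 0 <= delta by exact: le_trans X0G.
have W0 (i : 'I_m) s : 0 <= s < D i.+1 -> `|input D U s 0 i| <= delta.
  by move=> sD; rewrite mxE; exact: W0G.
have sge : delta + eps <= eta.
  have h1 : A * delta <= B - alpha1 (m%:R * eps).
    apply: (le_trans (bA _ delta0)); rewrite -OmB.
    exact: class_K_le b0K delta0 GOm.
  have h2 := aA _ me0.
  have h3 : A * eps <= A * (m%:R * eps).
    by rewrite ler_pM2l // ler_peMl ?(ltW eps0) // ler1n.
  have h4 : A * (delta + eps) <= B by rewrite mulrDr (le_trans (lerD h1 (le_trans h3 h2))) // subrK.
  have h5 : B <= A * eta.
    by rewrite /A mulrDl divfK ?gt_eqF // lerDr mulr_ge0 ?(ltW eta0) // (le_trans _ A01).
  by rewrite -(ler_pM2l A_gt0) (le_trans h4).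
have s0 : 0 <= delta + eps by rewrite addr_ge0 // ltW.
have epsle : eps <= delta + eps by rewrite lerDr.
have ee : eps <= eta by exact: le_trans sge.
have eps0' := ltW eps0.
have cq c : 0 <= c -> c <= Q -> c * (delta + eps) < mu by move=> ? ?; exact: small.
have cqe c : 0 <= c -> c <= Q -> c * eps < mu by move=> ? ?; exact: small.
have C0' := ltW C0; have g0 : 0 <= g by exact: le_trans g1.
have C1Q : 0 <= C + 1 by exact: addr_ge0.
have LAQ : 0 <= L * A1 + (1 + C) by rewrite addr_ge0 ?addr_ge0 // ltW.
have gs : gain m D L ^+ m * (delta + eps) <= r / L / 2.
  exact: ltW (lt_le_trans (cq g g0 gQ) mu_rho).
have gse : gain m D L ^+ m * eps <= r / L / 2.
  exact: ltW (lt_le_trans (cqe g g0 gQ) mu_rho).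
have k0 : forall k, kappa k 0 = 0.
  apply: (feedback_zero D0 D1 D_le f_lip f0 kc P_predictor L1 r0 fL kL PhC PhiD err
    rXX rUU cl eps0 delta0 X0G W0 gs) => k nz.
  exact: lt_le_trans (cq (C + 1) C1Q CQ) (muk k nz).
have sm : forall T, small_until D L r X U T.
  apply: (stays_small D0 D1 D_le f_lip f0 kc P_predictor L1 r0 fL kL PhC PhiD err
    rXX rUU cl eps0 delta0 X0G W0 k0 gse bIK gIK iss).
    rewrite -/A1 -/C -/rho mulrA -mulrDl.
    exact: lt_le_trans (cq _ LAQ LQ) mu_rho.
  rewrite -/A1 -/C -/rho.
  have i1 : bI (n%:R * (A1 * (delta + eps))) 0 < e.
    apply: hd1; rewrite mulrA -/Kx mulr_ge0 ?(ltW K0) //=.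
    exact: ltW (lt_le_trans (cq Kx (ltW K0) KQ) mud1).
  have i2 : gI (m%:R * (C * eps)) < e.
    apply: hd2; rewrite mulrA mulr_ge0 ?(ltW mC0) //=.
    exact: ltW (lt_le_trans (cqe _ (ltW mC0) mQ) mud2).
  have i3 : C * eps < rho / 2.
    apply: lt_le_trans murho; apply: cqe => //; apply: le_trans CQ.
    by rewrite lerDl.
  have i4 : L * (bI (n%:R * (A1 * (delta + eps))) 0 + gI (m%:R * (C * eps))) < rho / 2.
    have -> : rho / 2 = L * (e + e) by rewrite /e; field; rewrite gt_eqF.
    by rewrite ltr_pM2l // ltrD.
  by rewrite [ltRHS]splitr ltrD.
apply: (le_trans (Gamma_bound D0 D1 D_le f_lip f0 kc P_predictor L1 r0 fL kL PhC PhiD err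
    rXX rUU cl eps0 delta0 X0G W0 k0 gse bIK gIK iss sm t0)).
rewrite -/A1 -/C -/A0 -/Kx; apply: lerD.
  by rewrite /beta ler_wpM2r // addr_ge0 ?bge // mulr_ge0 ?expR_ge0.
have em : eps <= m%:R * eps by rewrite ler_peMl // ler1n.
rewrite /alpha1; apply: ler_pM => //.
- exact: le_trans A01.
- by rewrite !addr_ge0 ?bge // [m%:R * (C * eps)]mulrCA gge.
- rewrite [m%:R * (C * eps)]mulrCA; apply: lerD => //; apply: lerD => //.
  apply: (class_K_le bK0); first by rewrite mulr_ge0 // ltW.
  by rewrite ler_pM2l.
Qed.
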